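(* Let $X$ be a locally conical homogeneous Euclidean neighborhood retract that is not a topological manifold (without boundary). Then each connected component of $X$ is strongly $n$-homogeneous for all $n \geq 2$, and $X$ is countable dense homogeneous.
   Context: A space is a Euclidean neighborhood retract if it is homeomorphic to a retract of an open subset of $\mathbb{R}^m$ for some $m \geq 1$. (The Bing-Borsuk Conjecture asserts that every homogeneous Euclidean neighborhood retract is a topological manifold without boundary; so $X$ is a locally conical counterexample to this conjecture.) The open cone over a compact space $Y$ is the quotient space $Y \times (0,\infty]/Y \times \{\infty\}$. A space is locally conical if every point of the space has an open neighborhood that is homeomorphic to the open cone over a compact space (the point is not required to correspond to the cone vertex). A space $X$ is homogeneous if for any two points $p$ and $q$ of $X$ there is a homeomorphism of $X$ onto itself that maps $p$ to $q$. For $n \geq 1$, a space $X$ is strongly $n$-homogeneous if every bijection between two $n$-element subsets of $X$ can be extended to a homeomorphism of $X$ onto itself. A space $X$ is countable dense homogeneous if for any two countable dense subsets $A$ and $B$ of $X$ there is a homeomorphism of $X$ onto itself that maps $A$ onto $B$. *)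

(* Defs.v *)
(* The real line is an arbitrary [R : realType]. *)
From HB Require Import structures.
From mathcomp Require Import all_boot all_order all_algebra generic_quotient.
From mathcomp Require Import all_classical all_reals all_analysis.

Set Implicit Arguments.
Unset Strict Implicit.
Unset Printing Implicit Defensive.

Import Order.TTheory GRing.Theory Num.Theory.
Import numFieldNormedType.Exports.

Local Open Scope classical_set_scope.
Local Open Scope ring_scope.
Local Open Scope quotient_scope.
Local Open Scope card_scope.

(* A set used as a type is [set_type], which carries the subspace topology
   (unlike [subspace A], whose points outside A are isolated). *)

Definition homeomorphism (X Y : topologicalType) (f : X -> Y) : Prop :=
  continuous f /\
  exists g : Y -> X, [/\ continuous g, cancel f g & cancel g f].

Definition homeomorphic (X Y : topologicalType) : Prop :=
  exists f : X -> Y, homeomorphism f.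

(* The retraction U -> A is given by a function on the whole of T, of which
   only the restriction to U matters. *)
Definition is_retract (T : topologicalType) (A U : set T) : Prop :=
  A `<=` U /\
  exists r : T -> T,
    [/\ {within U, continuous r},
        (forall x, U x -> A (r x)) &
        (forall x, A x -> r x = x)].

Definition euclidean_neighborhood_retract (R : realType)
    (X : topologicalType) : Prop :=
  exists (m : nat) (U A : set 'rV[R]_m),
    [/\ (1 <= m)%N, open U, is_retract A U & homeomorphic X A].

(* The dimension 0 is allowed, so that countable discrete spaces are
   manifolds. *)
Definition topological_manifold (R : realType) (X : topologicalType) : Prop :=
  [/\ hausdorff_space X, @second_countable X &
      exists n : nat, forall x : X,
        exists (U : set X) (V : set 'rV[R]_n),
          [/\ open U, U x, open V & homeomorphic U V]].

Definition cylinder (R : realType) (Y : topologicalType) : topologicalType :=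
  (Y * set_type [set t : \bar R | (0 < t)%E])%type.

Section open_cone.
Context (R : realType) (Y : topologicalType).

(* Identifies all the points of Y x {+oo}. *)
Definition cone_rel (p q : cylinder R Y) : bool :=
  (p == q) || ((val p.2 == +oo%E) && (val q.2 == +oo%E)).

Lemma cone_rel_refl : reflexive cone_rel.
Proof. by move=> p; rewrite /cone_rel eqxx. Qed.

Lemma cone_rel_sym : symmetric cone_rel.
Proof. by move=> p q; rewrite /cone_rel eq_sym andbC. Qed.

Lemma cone_rel_trans : transitive cone_rel.
Proof.
move=> q p r /orP[/eqP->//|/andP[p1 q1]] /orP[/eqP<-|/andP[_ r1]];
  by rewrite /cone_rel p1 ?q1 ?r1 orbT.
Qed.

Canonical cone_equiv := EquivRel cone_rel
  cone_rel_refl cone_rel_sym cone_rel_trans.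

(* When Y is empty this is the empty space, not a point. *)
Definition open_cone : topologicalType :=
  quotient_topology {eq_quot cone_equiv}.

End open_cone.

(* The vertex of the cone need not correspond to x. *)
Definition locally_conical (R : realType) (X : topologicalType) : Prop :=
  forall x : X, exists (U : set X) (Y : topologicalType),
    [/\ open U, U x, compact [set: Y] & homeomorphic U (open_cone R Y)].

Definition homogeneous (X : topologicalType) : Prop :=
  forall p q : X, exists h : X -> X, homeomorphism h /\ h p = q.

(* The bijection A -> B is given by a function on the whole of X, of which
   only the restriction to A matters. *)
Definition strongly_homogeneous (n : nat) (X : topologicalType) : Prop :=
  forall (A B : set X) (f : X -> X),
    A #= `I_n -> B #= `I_n -> set_bij A B f ->
    exists h : X -> X, homeomorphism h /\ (forall x, A x -> h x = f x).

Definition countable_dense_homogeneous (X : topologicalType) : Prop :=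
  forall A B : set X,
    countable A -> dense A -> countable B -> dense B ->
    exists h : X -> X, homeomorphism h /\ h @` A = B.

(* Main.v *)
From HB Require Import structures.
Require Import Defs.
From mathcomp Require Import all_boot all_order all_algebra generic_quotient.
From mathcomp Require Import all_classical all_reals all_analysis.
From mathcomp Require Import ring lra.

Set Implicit Arguments.
Unset Strict Implicit.
Unset Printing Implicit Defensive.

Import Order.TTheory GRing.Theory Num.Theory.
Import numFieldNormedType.Exports.

Local Open Scope classical_set_scope.
Local Open Scope ring_scope.

(** By homogeneity every point of [X] is the vertex of a conical neighborhood,
    all with the same base [Y].  Stretching such a cone along its rays, by a
    homeomorphism with support inside the cone, brings any prescribed point
    arbitrarily close to the vertex, though never onto it.  This is the only
    use of the conical structure for moving points ([pushable_vertex]).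

    The size of the cone at a point is not under control, but the Baire
    category theorem shows that near some point the cones are uniformly large
    at a dense set of vertices.  Hence near that point, and therefore near
    every point, any [z] can be moved arbitrarily close to any other [w] by
    homeomorphisms of small support ([pushable_almost_somewhere]).  The
    approximation is made exact as in the proof of the open mapping theorem
    for Polish groups: [z] and [w] are moved alternately towards each other
    by ever smaller homeomorphisms, whose infinite compositions [F] and [H]
    are homeomorphisms with [F z = H w], so that [H^-1 F] maps [z] to [w]
    ([exact_homogeneity]).  Thus [X] is strongly locally homogeneous: every
    neighborhood of a point contains the supports of homeomorphisms that move
    any two points of some smaller neighborhood to each other.  The infinite
    compositions need a complete metric; as a retract of an open subset of a
    Euclidean space, [X] has one ([retract_complete_metric]).

    Countable dense homogeneity follows from strong local homogeneity by a
    back-and-forth construction, again with an infinite composition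
    ([strongly_locally_homogeneous_cdh]).

    For strong [n]-homogeneity, the points are moved to their targets one at a
    time, keeping fixed those that have arrived.  In a connected open set the
    orbits of the homeomorphisms supported in this set are open, so there is
    only one; it remains to see that finite sets do not disconnect a
    component.  Away from the vertex a cone over [Y] is the product of [Y]
    with a line.  If a point [y] of [Y] is not isolated, then a product of a
    small nondegenerate connected set around [y] with an interval is not
    disconnected by a point ([nonseparating_product]), and by homogeneity no
    point of [X] separates [X] locally.  If [y] is isolated, then the ray
    through [y] is open, so that [X] is locally Euclidean of dimension 1 and a
    manifold, which is excluded ([isolated_euclidean]). *)

(** * Self-homeomorphisms and their supports *)

Section selfhomeo.
Context (X : topologicalType).

Record selfhomeo := SelfHomeo {
  fwd :> X -> X;
  bwd : X -> X;
  fwd_continuous : continuous fwd;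
  bwd_continuous : continuous bwd;
  fwdK : cancel fwd bwd;
  bwdK : cancel bwd fwd }.

Lemma selfhomeoP (h : X -> X) :
  homeomorphism h <-> exists g : selfhomeo, h = g :> (X -> X).
Proof.
split=> [[hc [g [gc hg gh]]]|[g ->]]; first by exists (SelfHomeo hc gc hg gh).
split; first exact: fwd_continuous.
exists (bwd g); split;
  [exact: bwd_continuous | exact: fwdK | exact: bwdK].
Qed.

Definition homeo_id : selfhomeo :=
  @SelfHomeo id id (fun x => @cvg_id _ _) (fun x => @cvg_id _ _)
    (fun x => erefl) (fun x => erefl).

Definition homeo_inv (f : selfhomeo) : selfhomeo :=
  SelfHomeo (@bwd_continuous f) (@fwd_continuous f) (@bwdK f) (@fwdK f).

Definition homeo_comp (g f : selfhomeo) : selfhomeo :=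
  @SelfHomeo (g \o f) (bwd f \o bwd g)
    (fun x => continuous_comp (@fwd_continuous f x) (@fwd_continuous g (f x)))
    (fun x => continuous_comp (@bwd_continuous g x)
                (@bwd_continuous f (bwd g x)))
    (can_comp (@fwdK g) (@fwdK f))
    (can_comp (@bwdK f) (@bwdK g)).

Lemma fwd_inj (f : selfhomeo) : injective f.
Proof. exact: can_inj (@fwdK f). Qed.

Lemma open_fwd (f : selfhomeo) (A : set X) : open A -> open (f @` A).
Proof.
have -> : f @` A = bwd f @^-1` A.
  apply/seteqP; split=> [_ [x Ax <-]|x Ax] /=; first by rewrite fwdK.
  by exists (bwd f x) => //; rewrite bwdK.
by apply: open_comp => x _; exact: bwd_continuous.
Qed.

Lemma nbhs_fwd (f : selfhomeo) (x : X) (A : set X) :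
  nbhs x A -> nbhs (f x) (bwd f @^-1` A).
Proof. by move=> xA; apply: bwd_continuous; rewrite fwdK. Qed.

(** The support of [g] is here any set outside which [g] is the identity; it
    need not be closed. *)
Definition supported (V : set X) (g : selfhomeo) := forall u, ~ V u -> g u = u.

Lemma supported_stable (V : set X) (g : selfhomeo) (u : X) :
  supported V g -> V (g u) <-> V u.
Proof.
move=> gV; split=> Vu; apply: contrapT => nV.
  by apply: (nV); rewrite -(gV _ nV).
by apply: (nV); rewrite (fwd_inj (gV _ nV)).
Qed.

Lemma supported_inv (V : set X) (g : selfhomeo) :
  supported V g -> supported V (homeo_inv g).
Proof. by move=> gV u nVu /=; rewrite -{1}(gV _ nVu) fwdK. Qed.

Lemma supported_comp (V : set X) (g f : selfhomeo) :
  supported V g -> supported V f -> supported V (homeo_comp g f).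
Proof. by move=> gV fV u nVu /=; rewrite fV // gV. Qed.

Lemma supportedS (V W : set X) (g : selfhomeo) :
  V `<=` W -> supported V g -> supported W g.
Proof. by move=> VW gV u nWu; apply: gV => /VW. Qed.

Lemma supported_conj (V : set X) (h g : selfhomeo) :
  supported V g ->
  supported (bwd h @^-1` V) (homeo_comp h (homeo_comp g (homeo_inv h))).
Proof. by move=> gV u nVu /=; rewrite gV // bwdK. Qed.

End selfhomeo.

(** * Complete metrics, limits of homeomorphisms and Baire category *)

Section complete_metric.
Context (R : realType) (X : topologicalType).

(** Completeness is stated for the sequences with geometrically decreasing
    steps, which are those that the constructions below produce. *)
Record complete_metric (d : X -> X -> R) : Prop := CompleteMetric {
  dist_refl : forall x, d x x = 0;
  dist_sep : forall x y, d x y <= 0 -> x = y;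
  dist_sym : forall x y, d x y = d y x;
  dist_tri : forall x y z, d x z <= d x y + d y z;
  nbhs_dist : forall x (A : set X),
    nbhs x A <-> exists2 e, 0 < e & forall y, d x y < e -> A y;
  dist_complete : forall u : nat -> X,
    (forall n, d (u n) (u n.+1) <= 2^-1 ^+ n) ->
    exists l, forall e, 0 < e -> exists N, forall n, (N <= n)%N -> d (u n) l < e
}.

End complete_metric.

(** Dependent choice for a relation and an invariant that depend on the step:
    the step number is carried along in the state. *)
Lemma dependent_choice_nat (T : Type) (I : nat -> T -> Prop)
    (S : nat -> T -> T -> Prop) (t0 : T) :
  I 0%N t0 ->
  (forall n t, I n t -> exists t', I n.+1 t' /\ S n t t') ->
  exists f : nat -> T,
    f 0%N = t0 /\ forall n, I n (f n) /\ S n (f n) (f n.+1).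
Proof.
move=> I0 step.
pose St := {nt : nat * T | I nt.1 nt.2}.
pose next (s s' : St) := (sval s').1 = (sval s).1.+1 /\
  S (sval s).1 (sval s).2 (sval s').2.
have ex s : {s' : St | next s s'}.
  case: s => -[n t] /= Int; apply: cid.
  have [t' [It' St']] := step n t Int.
  by exists (exist (fun nt : nat * T => I nt.1 nt.2) (n.+1, t') It').
have [f [f0 fS]] := dependent_choice ex
  (exist (fun nt : nat * T => I nt.1 nt.2) (0%N, t0) I0).
have fn n : (sval (f n)).1 = n.
  by elim: n => [|n IHn]; rewrite ?f0 // (fS n).1 IHn.
exists (fun n => (sval (f n)).2); split; first by rewrite f0.
by move=> n; have := svalP (f n); have := (fS n).2; rewrite fn.
Qed.

Lemma small_pow2 (R : realType) (e : R) : 0 < e ->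
  exists N, forall n, (N <= n)%N -> 2^-1 ^+ n < e.
Proof.
move=> e0; have h : `|2^-1 : R| < 1 by rewrite ger0_norm; lra.
have /cvgrPdist_lt/(_ e e0)[N _ HN] := cvg_expr h.
by exists N => n /HN /=; rewrite sub0r normrN ger0_norm // exprn_ge0.
Qed.

Lemma geometric_tail (R : realType) (T : Type) (d : T -> T -> R) (u : nat -> T) :
  (forall x, d x x = 0) -> (forall x y z, d x z <= d x y + d y z) ->
  (forall n, d (u n) (u n.+1) <= 2^-1 ^+ n) ->
  forall n m, (n <= m)%N -> d (u n) (u m) <= 2 * 2^-1 ^+ n.
Proof.
move=> d_refl d_tri fast n m /subnKC <-; move: (m - n)%N => k.
have : (0 : R) <= 2^-1 ^+ (n + k)%N by rewrite exprn_ge0.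
suff : d (u n) (u (n + k)%N) <= 2 * 2^-1 ^+ n - 2 * 2^-1 ^+ (n + k)%N by lra.
elim: k => [|k IH]; first by rewrite addn0 subrr d_refl.
rewrite addnS; have := d_tri (u n) (u (n + k)%N) (u (n + k).+1).
by have := fast (n + k)%N; rewrite exprS; move: IH; lra.
Qed.

Section metric_theory.
Context (R : realType) (X : topologicalType) (d : X -> X -> R).
Hypothesis dP : complete_metric d.

Local Notation eps n := (2^-1 ^+ n : R).

Definition dball x (e : R) : set X := [set y | d x y < e].

Lemma nbhs_dball x e : 0 < e -> nbhs x (dball x e).
Proof. by move=> e0; apply/(nbhs_dist dP); exists e. Qed.

Lemma open_dball x e : open (dball x e).
Proof.
rewrite openE => y /= xye; apply/(nbhs_dist dP).
exists (e - d x y) => [|z yz]; first by rewrite subr_gt0.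
by rewrite /dball /=; have := dist_tri dP x y z; lra.
Qed.

Lemma complete_metric_hausdorff : hausdorff_space X.
Proof.
move=> x y xy; apply: (dist_sep dP); rewrite leNgt; apply/negP => dxy.
have e0 : 0 < d x y / 2 by lra.
have [z [/= xz yz]] := xy _ _ (nbhs_dball x e0) (nbhs_dball y e0).
by move: xz yz; rewrite /dball /= (dist_sym dP y) => xz yz;
  have := dist_tri dP x z y; lra.
Qed.

Definition dlim (u : nat -> X) (l : X) :=
  forall e, 0 < e -> exists N, forall n, (N <= n)%N -> d (u n) l < e.

Lemma dlim_unique u l l' : dlim u l -> dlim u l' -> l = l'.
Proof.
move=> ul ul'; apply: (dist_sep dP); apply/ler_addgt0Pl => e e0.
have e20 : 0 < e / 2 by lra.
have [N HN] := ul _ e20; have [N' HN'] := ul' _ e20.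
have := HN _ (leq_maxl N N'); have := HN' _ (leq_maxr N N').
have := dist_tri dP l (u (maxn N N')) l'; rewrite (dist_sym dP l (u _)).
by lra.
Qed.

Lemma dlim_eventually_eq u l N :
  (forall n, (N <= n)%N -> u n = l) -> dlim u l.
Proof.
by move=> H e e0; exists N => n /H ->; rewrite (dist_refl dP).
Qed.

Lemma continuous_dlim (f : X -> X) u l :
  continuous f -> dlim u l -> dlim (f \o u) (f l).
Proof.
move=> fc ul e e0.
have /(nbhs_dist dP)[r r0 hr] := fc l _ (nbhs_dball (f l) e0).
have [N HN] := ul _ r0; exists N => n /HN; rewrite (dist_sym dP) => /hr.
by rewrite /dball /= (dist_sym dP).
Qed.

Lemma fast_uniform_limit (f : nat -> X -> X) :
  (forall n, continuous (f n)) ->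
  (forall n u, d (f n u) (f n.+1 u) <= eps n) ->
  exists g : X -> X, continuous g /\
    forall e, 0 < e -> exists N, forall n, (N <= n)%N ->
      forall u, d (f n u) (g u) < e.
Proof.
move=> fc fast.
have lims u : exists l, dlim (f ^~ u) l := dist_complete dP (fast ^~ u).
have [g gP] := choice lims.
have bound n u : d (f n u) (g u) <= 2 * eps n.
  apply/ler_addgt0Pl => e e0; have [N HN] := gP u _ e0.
  have := HN _ (leq_addl n N).
  have := geometric_tail (dist_refl dP) (dist_tri dP) (fast ^~ u) (leq_addr N n).
  by have := dist_tri dP (f n u) (f (n + N)%N u) (g u); lra.
have unif e : 0 < e -> exists N, forall n, (N <= n)%N ->
    forall u, d (f n u) (g u) < e.
  move=> e0; have [N HN] := @small_pow2 R (e / 2) ltac:(lra).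
  by exists N => n /HN en u; have := bound n u; lra.
exists g; split=> // x A /(nbhs_dist dP)[e e0 eA].
have [N HN] := unif (e / 3) ltac:(lra).
have /(nbhs_dist dP)[r r0 hr] := fc N x _ (@nbhs_dball (f N x) (e / 3) ltac:(lra)).
apply/(nbhs_dist dP); exists r => // y /hr; rewrite /dball /= => h; apply: eA.
have := HN _ (leqnn N) x; have := HN _ (leqnn N) y.
have := dist_tri dP (g x) (f N x) (g y); rewrite (dist_sym dP (g x) (f N x)).
have := dist_tri dP (f N x) (f N y) (g y).
lra.
Qed.

(** Uniform closeness of the inverses has to be asked for as well: a uniform
    limit of homeomorphisms need not be injective. *)
Lemma homeo_limit (F : nat -> selfhomeo X) :
  (forall n u, d (F n u) (F n.+1 u) <= eps n) ->
  (forall n u, d (bwd (F n) u) (bwd (F n.+1) u) <= eps n) ->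
  exists G : selfhomeo X, forall u,
    dlim (fun n => F n u) (G u) /\ dlim (fun n => bwd (F n) u) (bwd G u).
Proof.
have main (F1 F2 : nat -> X -> X) (g1 g2 : X -> X) :
  (forall n, cancel (F1 n) (F2 n)) -> continuous g2 ->
  (forall u, dlim (F1 ^~ u) (g1 u)) ->
  (forall e, 0 < e -> exists N, forall n, (N <= n)%N ->
      forall u, d (F2 n u) (g2 u) < e) ->
  cancel g1 g2.
  (* [g2 (F1 n u)] tends to [g2 (g1 u)] because [g2] is continuous, and to [u]
     because it is uniformly close to [F2 n (F1 n u)]. *)
  move=> FK g2c g1lim g2lim u; symmetry.
  apply: (@dlim_unique (fun n => g2 (F1 n u))); last first.
    exact: continuous_dlim.
  move=> e /g2lim[N HN]; exists N => n /HN/(_ (F1 n u)).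
  by rewrite FK (dist_sym dP).
have pw (F1 : nat -> X -> X) g u : (forall e, 0 < e -> exists N,
    forall n, (N <= n)%N -> forall u, d (F1 n u) (g u) < e) ->
    dlim (F1 ^~ u) (g u).
  by move=> H e /H[N HN]; exists N => n /HN.
move=> fast fastb.
have [g [gc glim]] := fast_uniform_limit (fun n => @fwd_continuous _ (F n)) fast.
have [k [kc klim]] := fast_uniform_limit (fun n => @bwd_continuous _ (F n)) fastb.
have gk : cancel g k := main _ _ g k (fun n => @fwdK _ (F n)) kc
  (fun u => pw _ _ u glim) klim.
have kg : cancel k g := main _ _ k g (fun n => @bwdK _ (F n)) gc
  (fun u => pw _ _ u klim) glim.
exists (SelfHomeo gc kc gk kg) => u; split;
  [exact: pw _ _ u glim | exact: pw _ _ u klim].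
Qed.

(** Nested closed balls of radius at most [2^-n], the one of step [n.+1] being
    contained in the open ball of step [n] and in [D n]. *)
Lemma metric_baire (D : nat -> set X) :
  (forall n, open (D n)) -> (forall n, dense (D n)) ->
  dense (\bigcap_n D n).
Proof.
move=> Do Dd O [x0 Ox0] Oo.
pose cball (s : X * R) : set X := [set y | d s.1 y <= s.2].
pose I n (s : X * R) := [/\ 0 < s.2, s.2 <= eps n & cball s `<=` O].
pose S n (s s' : X * R) := cball s' `<=` dball s.1 s.2 `&` D n.
have shrink n (x : X) (A : set X) : nbhs x A ->
    exists r, [/\ 0 < r, r <= eps n & cball (x, r) `<=` A].
  move=> /(nbhs_dist dP)[e e0 eA]; have en0 : 0 < eps n by rewrite exprn_gt0.
  exists (Num.min (e / 2) (eps n)); split.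
  - by rewrite lt_min en0; lra.
  - by rewrite ge_min lexx orbT.
  - by move=> y; rewrite /cball /= le_min => /andP[xy _]; apply: eA; lra.
have [r [r0 r1 rO]] := shrink 0%N x0 O (open_nbhs_nbhs (conj Oo Ox0)).
have I0 : I 0%N (x0, r) by [].
have step n s : I n s -> exists s', I n.+1 s' /\ S n s s'.
  case: s => x s [/= s0 sn sO].
  have xs : dball x s !=set0.
    by exists x; exact: nbhs_singleton (nbhs_dball x s0).
  have [y [/= xy Dy]] := Dd n (dball x s) xs (open_dball x s).
  have yA : nbhs y (dball x s `&` D n).
    by apply: filterI; apply: open_nbhs_nbhs; split=> //; exact: open_dball.
  have [t [t0 tn tA]] := shrink n.+1 y _ yA.
  exists (y, t); split; last exact: tA.
  by split=> // z /tA[xz _]; apply: sO; exact: ltW.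
have [f [f0 fP]] := dependent_choice_nat I0 step.
have fS n : d (f n).1 (f n.+1).1 <= eps n.
  have [[_ en _] Sn] := fP n; have [[p _ _] _] := fP n.+1.
  have [] := Sn (f n.+1).1; first by rewrite /cball /= (dist_refl dP) ltW.
  by rewrite /dball /= => h _; exact: le_trans (ltW h) en.
have [l lP] := dist_complete dP fS.
have nest n k : dball (f (n + k)%N).1 (f (n + k)%N).2 `<=` dball (f n).1 (f n).2.
  elim: k => [|k IH]; first by rewrite addn0.
  apply: subset_trans IH; rewrite addnS => y /= hy.
  by have [_ /(_ y (ltW hy))[]] := fP (n + k)%N.
have inl n : cball (f n) l.
  apply/ler_addgt0Pl => e e0; have [N HN] := lP _ e0.
  have h1 := HN _ (leq_addl n N).
  have [[p _ _] _] := fP (n + N)%N.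
  have := nest n N _ (nbhs_singleton (nbhs_dball (f (n + N)%N).1 p)).
  rewrite /dball /=.
  by have := dist_tri dP (f n).1 (f (n + N)%N).1 l; lra.
exists l; split; first by have [[_ _]] := fP 0%N => /(_ l (inl 0%N)).
by move=> n _; have [_ /(_ l (inl n.+1))[]] := fP n.
Qed.

End metric_theory.

(** * Strong local homogeneity *)

Section local_homogeneity.
Context (X : topologicalType).

Definition approach (V : set X) (z w : X) :=
  forall N, nbhs w N -> exists g : selfhomeo X, supported V g /\ N (g z).

(** What radial stretching gives at the vertex of a cone: points can be pushed
    towards [x], which is itself the only target. *)
Definition pushable (x : X) := forall V, nbhs x V ->
  exists2 O, nbhs x O & forall z, O z -> approach V z x.

Definition almost_locally_homogeneous (x : X) := forall V, nbhs x V ->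
  exists2 W, nbhs x W & forall z w, W z -> W w -> approach V z w.

Definition strongly_locally_homogeneous (x : X) := forall V, nbhs x V ->
  exists2 W, nbhs x W & forall z w, W z -> W w ->
    exists g : selfhomeo X, supported V g /\ g z = w.

Lemma approach_fwd (h : selfhomeo X) (V : set X) (z w : X) :
  approach (h @^-1` V) z w -> approach V (h z) (h w).
Proof.
move=> app N hwN; have [g [gV gN]] := app (h @^-1` N) (@fwd_continuous _ h w N hwN).
exists (homeo_comp h (homeo_comp g (homeo_inv h))); split; last first.
  by rewrite /= fwdK.
by apply: (supportedS _ (supported_conj gV)) => u /=; rewrite bwdK.
Qed.

Lemma pushable_fwd (h : selfhomeo X) (x : X) : pushable x -> pushable (h x).
Proof.
move=> px V hxV; have [U xU H] := px _ (@fwd_continuous _ h x V hxV).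
exists (bwd h @^-1` U); first exact: nbhs_fwd.
by move=> z /= Uz; rewrite -[z](bwdK h); apply: approach_fwd; exact: H.
Qed.

Lemma almost_locally_homogeneous_fwd (h : selfhomeo X) (x : X) :
  almost_locally_homogeneous x -> almost_locally_homogeneous (h x).
Proof.
move=> px V hxV; have [W xW H] := px _ (@fwd_continuous _ h x V hxV).
exists (bwd h @^-1` W); first exact: nbhs_fwd.
move=> z w /= Wz Ww; rewrite -[z](bwdK h) -[w](bwdK h).
by apply: approach_fwd; exact: H.
Qed.

(** Each local property below is proved at one well chosen point, which
    homogeneity then makes representative of all points. *)
Lemma homogeneous_transport (P : X -> Prop) :
  homogeneous X -> (forall (h : selfhomeo X) x, P x -> P (h x)) ->
  forall x, P x -> forall y, P y.
Proof.
move=> Xh Ph x Px y; have [h [/selfhomeoP[g ->] <-]] := Xh x y.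
exact: Ph.
Qed.

Context (R : realType) (d : X -> X -> R).
Hypothesis dP : complete_metric d.

Local Notation eps n := (2^-1 ^+ n : R).

(** The condition on the support of the next factor that makes an infinite
    composition converge, together with the inverses. *)
Definition unmoving (e : R) (F : selfhomeo X) (V : set X) :=
  forall g : selfhomeo X, supported V g -> forall u,
    d (F u) (g (F u)) <= e /\ d (bwd F u) (bwd F (bwd g u)) <= e.

(** A homeomorphism with support in [V] moves points within [V] only, so it is
    enough that [V] and its preimage under [F] be small. *)
Lemma unmoving_nbhs (F : selfhomeo X) (c : X) (e : R) : 0 < e ->
  exists2 V, nbhs c V & unmoving e F V.
Proof.
move=> e0; have e20 : 0 < e / 2 by lra.
exists (dball d c (e / 2) `&` bwd F @^-1` dball d (bwd F c) (e / 2)).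
  apply: filterI; first exact: nbhs_dball.
  by apply: bwd_continuous; exact: nbhs_dball.
set V := _ `&` _ => g gV.
have close (c1 x y : X) : dball d c1 (e / 2) x -> dball d c1 (e / 2) y ->
    d x y <= e.
  rewrite /dball /= => xc yc.
  by have := dist_tri dP x c1 y; rewrite (dist_sym dP x c1); lra.
have key (f : selfhomeo X) v : supported V f ->
    d v (f v) <= e /\ d (bwd F v) (bwd F (f v)) <= e.
  move=> fV; have [Vv|nVv] := pselect (V v); last first.
    by rewrite fV // !(dist_refl dP); split; exact: ltW.
  have [fv1 fv2] := (supported_stable v fV).2 Vv.
  have [v1 v2] := Vv.
  split; first exact: close v1 fv1.
  exact: close v2 fv2.
move=> u; split; first by have [] := key g (F u) gV.
by have [] := key (homeo_inv g) u (supported_inv gV).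
Qed.

Lemma unmovingS e F (V V' : set X) :
  V' `<=` V -> unmoving e F V -> unmoving e F V'.
Proof. by move=> V'V FV g gV'; apply: FV; exact: supportedS gV'. Qed.

Section exact_homogeneity.
Hypothesis alh : forall x, almost_locally_homogeneous x.
Variable V0 : set X.
Hypothesis V0_open : open V0.

(** The state of the construction, in which [F] has moved [z] and [H] has moved
    [w]: the next homeomorphism applied after [F] may displace it by [e], and
    such a homeomorphism can bring [F z] arbitrarily close to [H w]. *)
Let J e (z w : X) (F H : selfhomeo X) :=
  [/\ supported V0 F, supported V0 H & exists V : set X,
    [/\ V `<=` V0, unmoving e F V & approach V (F z) (H w)] ].

(** The point [F z] is moved towards [H w], and the two sides exchange their
    roles.  The order of the choices matters: the neighborhood of [H w] in
    which the following move will take place is chosen first, small enough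
    for [H], and [F z] is then moved so close to [H w] that this following
    move can bring [H w] back arbitrarily close to [F' z].  Moving only one of
    the points would require its new position to be close enough to the
    target for a tolerance that depends on the move itself. *)
Lemma half_step e e' z w F H : V0 w -> 0 < e' -> J e z w F H ->
  exists F' : selfhomeo X, [/\ J e' w z H F',
    forall u, d (F u) (F' u) <= e /\ d (bwd F u) (bwd F' u) <= e &
    d (F' z) (H w) < e'].
Proof.
move=> V0w e'0 [FV0 HV0 [V [VV0 FV app]]].
have [V1 wV1 HV1] := unmoving_nbhs H (H w) e'0.
have V0Hw : nbhs (H w) V0.
  by apply: open_nbhs_nbhs; split=> //; exact/supported_stable.
have [W wW WV] := alh (filterI wV1 V0Hw).
have [g [gV [gW gd]]] := app _ (filterI wW (nbhs_dball dP (H w) e'0)).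
exists (homeo_comp g F); split.
- split=> //; first by apply: supported_comp => //; exact: supportedS gV.
  exists (V1 `&` V0); split=> //; first exact: unmovingS HV1.
  by apply: WV => //; exact: nbhs_singleton.
- by move=> u /=; exact: FV.
- by rewrite (dist_sym dP).
Qed.

Lemma exact_homogeneity x : V0 x ->
  exists2 W, nbhs x W & forall z w, W z -> W w ->
    exists g : selfhomeo X, supported V0 g /\ g z = w.
Proof.
move=> V0x; have xV0 : nbhs x V0 by exact: open_nbhs_nbhs.
have e0 n : 0 < eps n by rewrite exprn_gt0.
have [V1 xV1 V1P] := unmoving_nbhs (homeo_id X) x (e0 0%N).
have [W xW WP] := alh (filterI xV1 xV0).
exists (W `&` V0) => [|z w [Wz V0z] [Ww V0w]]; first exact: filterI.
pose S n (s s' : selfhomeo X * selfhomeo X) := [/\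
  forall u, d (s.1 u) (s'.1 u) <= eps n /\ d (bwd s.1 u) (bwd s'.1 u) <= eps n,
  forall u, d (s.2 u) (s'.2 u) <= eps n /\ d (bwd s.2 u) (bwd s'.2 u) <= eps n &
  d (s'.2 w) (s'.1 z) < eps n.+1].
have J0 : J (eps 0) z w (homeo_id X) (homeo_id X).
  by split=> //; exists (V1 `&` V0); split=> //;
    [exact: unmovingS V1P | exact: WP].
have step n s : J (eps n) z w s.1 s.2 ->
    exists s', J (eps n.+1) z w s'.1 s'.2 /\ S n s s'.
  move=> Js; have [F [JF sF _]] := half_step V0w (e0 n) Js.
  have [H [JH sH FH]] := half_step V0z (e0 n.+1) JF.
  by exists (F, H).
have [f [f0 fP]] := dependent_choice_nat
  (I := fun n s => J (eps n) z w s.1 s.2) (t0 := (homeo_id X, homeo_id X)) J0 step.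
have fast n u : (d ((f n).1 u) ((f n.+1).1 u) <= eps n /\
    d (bwd (f n).1 u) (bwd (f n.+1).1 u) <= eps n) /\
    (d ((f n).2 u) ((f n.+1).2 u) <= eps n /\
    d (bwd (f n).2 u) (bwd (f n.+1).2 u) <= eps n).
  by have [_ [h1 h2 _]] := fP n; split; [exact: h1 | exact: h2].
have [F FP] := homeo_limit dP (F := fun n => (f n).1)
  (fun n u => (fast n u).1.1) (fun n u => (fast n u).1.2).
have [H HP] := homeo_limit dP (F := fun n => (f n).2)
  (fun n u => (fast n u).2.1) (fun n u => (fast n u).2.2).
have Fsupp : supported V0 F.
  move=> u nV0u; apply: (dlim_unique dP (FP u).1).
  by apply: (dlim_eventually_eq dP (N := 0%N)) => n _; have [[/(_ u nV0u)]] := fP n.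
have Hsupp : supported V0 H.
  move=> u nV0u; apply: (dlim_unique dP (HP u).1).
  by apply: (dlim_eventually_eq dP (N := 0%N)) => n _; have [[_ /(_ u nV0u)]] := fP n.
have FzHw : F z = H w.
  apply: (dlim_unique dP (FP z).1) => e e_gt0.
  have [N1 HN1] := (HP w).1 (e / 2) ltac:(lra).
  have [N2 HN2] := @small_pow2 R (e / 2) ltac:(lra).
  exists (maxn N1 N2).+1 => -[//|n]; rewrite ltnS geq_max => /andP[n1 n2].
  have := HN1 n.+1 (leqW n1); have := HN2 n.+1 (leqW n2).
  have [_ [_ _]] := fP n; rewrite (dist_sym dP).
  by have := dist_tri dP ((f n.+1).1 z) ((f n.+1).2 w) (H w); lra.
exists (homeo_comp (homeo_inv H) F); split; last by rewrite /= FzHw fwdK.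
exact: supported_comp (supported_inv Hsupp) Fsupp.
Qed.

End exact_homogeneity.

Lemma almost_strongly_locally_homogeneous :
  (forall x, almost_locally_homogeneous x) ->
  forall x, strongly_locally_homogeneous x.
Proof.
move=> alh x V xV.
have [W xW WP] := exact_homogeneity alh (@open_interior _ V)
  (nbhs_singleton (nbhs_interior xV)).
exists W => // z w Wz Ww; have [g [gV gz]] := WP z w Wz Ww.
by exists g; split=> //; apply: (supportedS _ gV); exact: interior_subset.
Qed.

(** Let [E n k] be the set of the points [x] towards which every point at
    distance less than [2^-n] can be pushed with support in the ball of radius
    [2^-k].  For each [k] these sets cover the space, so that a point [x]
    outside the boundaries of all their closures is, for each [k], interior to
    the closure of some [E n k].  Two points [z] and [w] near [x] then have a
    common neighbor [y] in [E n k], arbitrarily close to [w], and pushing [z]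
    towards [y] brings it close to [w]. *)
Lemma pushable_almost_somewhere : [set: X] !=set0 -> (forall x, pushable x) ->
  exists x, almost_locally_homogeneous x.
Proof.
move=> [x1 _] push.
pose E (n k : nat) := [set x | forall z, dball d x (eps n) z ->
  approach (dball d x (eps k)) z x].
have e0 n : 0 < eps n by rewrite exprn_gt0.
have E_cover k x : exists n, E n k x.
  have [U /(nbhs_dist dP)[e e_gt0 eU] UP] := push x _ (nbhs_dball dP x (e0 k)).
  have [n /(_ n (leqnn n)) en] := small_pow2 e_gt0.
  exists n => z; rewrite /dball /= => xz; apply: UP; apply: eU.
  exact: lt_trans en.
pose D (nk : nat * nat) := (closure (E nk.1 nk.2))° `|` ~` closure (E nk.1 nk.2).
have D_open nk : open (D nk).
  apply: openU; first exact: open_interior.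
  by apply: closed_openC; exact: closed_closure.
have D_dense nk : dense (D nk).
  move=> O [x Ox] Oo.
  have [ OE|/existsNP[y /not_implyP[Oy nEy]]] := pselect (O `<=` closure (E nk.1 nk.2)).
    exists x; split=> //; left.
    by apply: filterS OE _; exact: open_nbhs_nbhs.
  by exists y; split=> //; right.
have [f fsurj] : exists f : nat -> nat * nat, forall nk, exists i, f i = nk.
  exists (fun i => odflt (0%N, 0%N) (unpickle i)) => nk.
  by exists (pickle nk); rewrite pickleK.
have D_meet := metric_baire dP (fun i => D_open (f i)) (fun i => D_dense (f i)).
have [x [_ xD]] := D_meet setT (ex_intro _ x1 I) openT.
exists x => V /(nbhs_dist dP)[e e_gt0 eV].
have [k /(_ k (leqnn k)) ek] := @small_pow2 R (e / 2) ltac:(lra).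
have [n Enx] := E_cover k x.
have [i fi] := fsurj (n, k).
have : D (n, k) x by rewrite -fi; exact: xD.
case=> [/= xE|]; last by case; exact: subset_closure.
have r0 : 0 < Num.min (eps n / 4) (eps k / 4).
  by rewrite lt_min !divr_gt0.
exists ((closure (E n k))° `&` dball d x (Num.min (eps n / 4) (eps k / 4))).
  by apply: filterI; [exact: nbhs_interior | exact: nbhs_dball].
move=> z w [_ xz] [Ew xw] N wN.
have [y [Ey [Ny wy]]] : E n k `&` (N° `&`
    dball d w (Num.min (eps n / 4) (eps k / 4))) !=set0.
  apply: (interior_subset Ew); apply: filterI; first exact: nbhs_interior.
  exact: nbhs_dball.
move: xz xw wy; rewrite /dball /= !lt_min => /andP[xz1 xz2] /andP[xw1 xw2].
move=> /andP[wy1 wy2]; have en0 := e0 n; have ek0 := e0 k.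
have yz : dball d y (eps n) z.
  rewrite /dball /=; have := dist_tri dP y w z; have := dist_tri dP w x z.
  by rewrite (dist_sym dP w x) (dist_sym dP y w); lra.
have [g [gV Ng]] := Ey z yz N Ny.
exists g; split=> //; apply: (supportedS _ gV) => u; rewrite /dball /= => yu.
apply: eV; have := dist_tri dP x w u; have := dist_tri dP w y u.
lra.
Qed.

End local_homogeneity.

(** * Countable dense homogeneity *)

Lemma countable_range (T : Type) (A : set T) :
  countable A -> A !=set0 -> exists a : nat -> T, A = range a.
Proof.
move=> /countable_injP[f finj] [x0 Ax0].
have H n : exists x, A x /\ forall y, A y -> f y = n -> y = x.
  have [[x [Ax fx]]|nx] := pselect (exists x, A x /\ f x = n).
    exists x; split=> // y Ay fy; apply: finj; rewrite ?inE //.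
    by rewrite fy fx.
  by exists x0; split=> // y Ay fy; case: nx; exists y.
have [a aP] := choice H; exists a; apply/seteqP; split=> [x Ax|_ [n _ <-]].
  by exists (f x) => //; rewrite -((aP (f x)).2 x).
by have [] := aP n.
Qed.

Section back_and_forth.
Context (R : realType) (X : topologicalType) (d : X -> X -> R).
Hypothesis dP : complete_metric d.
Hypothesis slh : forall x : X, strongly_locally_homogeneous x.

Local Notation eps n := (2^-1 ^+ n : R).

Lemma nbhs_notin_seq (L : seq X) (c : X) :
  c \notin L -> nbhs c [set u | u \notin L].
Proof.
elim: L => [_|l L IH]; first by apply: filterS filterT => u.
rewrite in_cons negb_or => /andP[cl /IH cL].
have e0 : 0 < d c l.
  by rewrite ltNge; apply: contraNN cl => /(dist_sep dP) ->.
apply: filterS (filterI cL (nbhs_dball dP c e0)) => u [uL].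
rewrite /dball /= in_cons negb_or uL andbT => cu.
by apply: contraTneq cu => ->; rewrite ltxx.
Qed.

(** The basic move of the back-and-forth: near a point outside the finite set
    [L], any position can be corrected to any other without displacing [F]
    much and without disturbing what [F] maps to [L]. *)
Lemma steer (F : selfhomeo X) (L : seq X) (c : X) (e : R) :
  c \notin L -> 0 < e ->
  exists2 W, nbhs c W & forall z w, W z -> W w -> exists F' : selfhomeo X,
    [/\ forall u, d (F u) (F' u) <= e /\ d (bwd F u) (bwd F' u) <= e,
        forall l, l \in L -> bwd F' l = bwd F l & F' (bwd F z) = w].
Proof.
move=> cL e0; have [V cV FV] := unmoving_nbhs dP F c e0.
have [W cW WP] := slh (filterI cV (nbhs_notin_seq cL)).
exists W => // z w Wz Ww; have [g [gV gz]] := WP z w Wz Ww.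
exists (homeo_comp g F); split=> [u|l lL|] /=; last by rewrite bwdK.
- apply: FV; apply: (supportedS _ gV); exact: subIsetl.
- rewrite -[in bwd g l](gV l) ?fwdK // => -[_ /=].
  by rewrite lL.
Qed.

Section enumerated.
Variables (A B : set X) (a b : nat -> X).
Hypotheses (A_dense : dense A) (B_dense : dense B).
Hypotheses (Aa : forall n, A (a n)) (Bb : forall n, B (b n)).

(** [s.2] lists the images already settled, whose preimages all later steps
    preserve. *)
Let matched (s : selfhomeo X * seq X) :=
  forall l, l \in s.2 -> B l /\ A (bwd s.1 l).

Let extends (e : R) (s s' : selfhomeo X * seq X) :=
  [/\ matched s',
      forall u, d (s.1 u) (s'.1 u) <= e /\ d (bwd s.1 u) (bwd s'.1 u) <= e,
      {subset s.2 <= s'.2} &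
      forall l, l \in s.2 -> bwd s'.1 l = bwd s.1 l].

Lemma extends_refl e s : 0 <= e -> matched s -> extends e s s.
Proof. by move=> e0 ms; split=> // u; rewrite !(dist_refl dP). Qed.

Lemma extends_trans e s s' s'' :
  extends (e / 2) s s' -> extends (e / 2) s' s'' -> extends e s s''.
Proof.
move=> [_ h1 sub1 k1] [m2 h2 sub2 k2]; split=> // [u|l /sub1/sub2 //|l ls].
  have [h11 h12] := h1 u; have [h21 h22] := h2 u; split.
    by have := dist_tri dP (s.1 u) (s'.1 u) (s''.1 u); lra.
  by have := dist_tri dP (bwd s.1 u) (bwd s'.1 u) (bwd s''.1 u); lra.
by rewrite k2 ?sub1 // k1.
Qed.

Lemma match_cons e s (F' : selfhomeo X) l : matched s ->
  (forall u, d (s.1 u) (F' u) <= e /\ d (bwd s.1 u) (bwd F' u) <= e) ->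
  (forall l, l \in s.2 -> bwd F' l = bwd s.1 l) ->
  B l -> A (bwd F' l) -> extends e s (F', l :: s.2).
Proof.
move=> ms mv keep Bl Al; split=> //= [k|k kL]; last by rewrite in_cons kL orbT.
rewrite in_cons => /orP[/eqP->//|kL].
by split; [have [] := ms k kL | rewrite keep //; have [] := ms k kL].
Qed.

Lemma forth e s x : 0 < e -> matched s -> A x ->
  exists s', extends e s s' /\ s'.1 x \in s'.2.
Proof.
move=> e0 ms Ax; have [xL|xL] := boolP (s.1 x \in s.2).
  by exists s; split=> //; apply: extends_refl => //; exact: ltW.
have [W xW WP] := steer s.1 xL e0.
have Wx : W° !=set0 by exists (s.1 x).
have [y [Wy By]] := B_dense Wx (@open_interior _ W).
have [F' [mv keep F'x]] := WP (s.1 x) y (nbhs_singleton xW) (interior_subset Wy).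
move: F'x; rewrite fwdK => F'x.
exists (F', y :: s.2); split; last by rewrite /= F'x mem_head.
by apply: match_cons => //; rewrite -F'x fwdK.
Qed.

Lemma back e s y : 0 < e -> matched s -> B y ->
  exists s', extends e s s' /\ y \in s'.2.
Proof.
move=> e0 ms By; have [yL|yL] := boolP (y \in s.2).
  by exists s; split=> //; apply: extends_refl => //; exact: ltW.
have [W yW WP] := steer s.1 yL e0.
have oW : open (s.1 @^-1` W°).
  by apply: open_comp; [move=> x _; exact: fwd_continuous | exact: open_interior].
have Wy : s.1 @^-1` W° !=set0 by exists (bwd s.1 y); rewrite /= bwdK.
have [x [/= Wx Ax]] := A_dense Wy oW.
have [F' [mv keep F'x]] := WP (s.1 x) y (interior_subset Wx) (nbhs_singleton yW).
move: F'x; rewrite fwdK => F'x.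
exists (F', y :: s.2); split; last by rewrite /= mem_head.
by apply: match_cons => //; rewrite -F'x fwdK.
Qed.

Lemma back_and_forth : exists G : selfhomeo X,
  (forall n, B (G (a n))) /\ (forall n, A (bwd G (b n))).
Proof.
have e0 n : 0 < eps n by rewrite exprn_gt0.
pose S n s s' := [/\ extends (eps n) s s', s'.1 (a n) \in s'.2 & b n \in s'.2].
have m0 : matched (homeo_id X, [::]) by [].
have step n s : matched s -> exists s', matched s' /\ S n s s'.
  move=> ms; have h0 : 0 < eps n / 2 by rewrite divr_gt0.
  have [s1 [e1 as1]] := forth h0 ms (Aa n).
  have m1 : matched s1 by case: e1.
  have [s2 [e2 bs2]] := back h0 m1 (Bb n).
  exists s2; split; first by case: e2.
  split=> //; first exact: extends_trans e1 e2.
  case: e2 => _ _ sub keep; have := sub _ as1.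
  by rewrite -{2}[a n](fwdK s1.1) -keep // bwdK.
have [f [f0 fP]] := dependent_choice_nat (I := fun _ => matched) m0 step.
have ext n : extends (eps n) (f n) (f n.+1) by have [_ []] := fP n.
have fast n u : d ((f n).1 u) ((f n.+1).1 u) <= eps n /\
    d (bwd (f n).1 u) (bwd (f n.+1).1 u) <= eps n by case: (ext n).
have [G GP] := homeo_limit dP (F := fun n => (f n).1)
  (fun n u => (fast n u).1) (fun n u => (fast n u).2).
have stable n l : l \in (f n).2 -> bwd G l = bwd (f n).1 l.
  move=> ln; apply: (dlim_unique dP (GP l).2).
  apply: (dlim_eventually_eq dP (N := n)) => m /subnK <-.
  suff [] : l \in (f (m - n + n)%N).2 /\ bwd (f (m - n + n)%N).1 l = bwd (f n).1 l by [].
  elim: (m - n)%N => [//|k [lk bk]]; rewrite addSn.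
  by case: (ext (k + n)%N) => _ _ sub keep; rewrite sub // keep.
exists G; split=> n.
- have [_ [[m _ _ _] an _]] := fP n; have [Bl _] := m _ an.
  by have := stable _ _ an; rewrite fwdK => <-; rewrite bwdK.
- have [_ [[m _ _ _] _ bn]] := fP n; have [_] := m _ bn.
  by rewrite -(stable _ _ bn).
Qed.

End enumerated.

Lemma strongly_locally_homogeneous_cdh : countable_dense_homogeneous X.
Proof.
move=> A B Ac Ad Bc Bd.
have [[x0 _]|noX] := pselect ([set: X] !=set0); last first.
  exists id; split; first by apply/selfhomeoP; exists (homeo_id X).
  by apply/seteqP; split=> x; case: noX; exists x.
have [x [_ Ax]] := Ad setT (ex_intro _ x0 I) openT.
have [y [_ By]] := Bd setT (ex_intro _ x0 I) openT.
have [a Aa] := countable_range Ac (ex_intro _ x Ax).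
have [b Bb] := countable_range Bc (ex_intro _ y By).
have [n||G [GA GB]] := @back_and_forth A B a b Ad Bd; first by rewrite Aa; exists n.
  by move=> n; rewrite Bb; exists n.
exists G; split; first by apply/selfhomeoP; exists G.
apply/seteqP; split=> [_ [u + <-]|u].
  by rewrite {1}Aa => -[n _ <-].
rewrite {1}Bb => -[n _ <-]; exists (bwd G (b n)) => //.
by rewrite bwdK.
Qed.

End back_and_forth.

(** * Subspaces *)

Section subspaces.
Context (X : topologicalType) (S : set X).

Lemma set_val_continuous : continuous (fun z : set_type S => val z).
Proof. exact: (@initial_continuous (set_type S) X set_val). Qed.

Lemma continuous_into_subspace (Y : topologicalType) (f : Y -> set_type S) :
  continuous (fun y => val (f y)) -> continuous f.
Proof. exact: (@continuous_comp_initial _ Y X set_val f). Qed.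

Lemma nbhs_set_typeP (z : set_type S) (B : set (set_type S)) :
  nbhs z B <-> exists2 V, nbhs (val z) V & forall w : set_type S, V (val w) -> B w.
Proof.
split=> [|[V zV VB]].
  move=> -[_ [[V oV <-] /= Vz] VB]; exists V; first exact: open_nbhs_nbhs.
  by move=> w Vw; exact: VB.
by apply: filterS VB _; exact: set_val_continuous.
Qed.

End subspaces.

(** * Finite sets that do not disconnect, and strong n-homogeneity *)

Section connectedness.
Context (X : topologicalType).

Lemma connected_open_split (S O1 O2 : set X) : connected S ->
  open O1 -> open O2 -> S `<=` O1 `|` O2 -> S `&` O1 `&` O2 `<=` set0 ->
  S `&` O1 !=set0 -> S `<=` O1.
Proof.
move=> Sc O1o O2o S12 disj ne; suff <- : S `&` O1 = S by exact: subIsetr.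
apply: Sc => //; first by exists O1.
exists (~` O2); first exact: open_closedC.
apply/seteqP; split=> x [Sx h]; split=> //.
  by move=> O2x; apply: (disj x).
by have [] := S12 x Sx.
Qed.

Lemma connected_by_open_splits (S : set X) :
  (forall O1 O2, open O1 -> open O2 -> S `<=` O1 `|` O2 ->
    S `&` O1 `&` O2 `<=` set0 -> S `&` O1 !=set0 -> S `<=` O1) ->
  connected S.
Proof.
move=> H B Bne [C Co BC] [D Dc BD].
rewrite BC; apply/setIidPl; apply: (H C (~` D)) => //.
- exact: closed_openC.
- move=> x Sx; have [Dx|nDx] := pselect (D x); [left|by right].
  by have : B x by [rewrite BD]; rewrite BC => -[].
- move=> x [[Sx Cx] nDx]; apply: nDx.
  by have : B x by [rewrite BC]; rewrite BD => -[].
- by rewrite -BC.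
Qed.

Definition locally_connected_at (x : X) := forall V, nbhs x V ->
  exists W, [/\ nbhs x W, connected W & W `<=` V].

Definition nonseparating_at (x : X) := forall V, nbhs x V ->
  exists D, [/\ connected D, D `<=` V `\ x & nbhs x (x |` D)].

Lemma connected_fwd (h : selfhomeo X) (D : set X) :
  connected D -> connected (h @` D).
Proof.
move=> Dc; apply: connected_continuous_connected => //.
by apply: continuous_subspaceT; exact: fwd_continuous.
Qed.

Lemma locally_connected_fwd (h : selfhomeo X) (x : X) :
  locally_connected_at x -> locally_connected_at (h x).
Proof.
move=> lx V hxV; have [W [xW Wc WV]] := lx _ (@fwd_continuous _ h x V hxV).
exists (h @` W); split; last by move=> _ [y Wy <-]; exact: WV.
- apply: filterS (nbhs_fwd h xW) => y /= Wy.
  by exists (bwd h y) => //; rewrite bwdK.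
- exact: connected_fwd.
Qed.

Lemma nonseparating_fwd (h : selfhomeo X) (x : X) :
  nonseparating_at x -> nonseparating_at (h x).
Proof.
move=> lx V hxV; have [D [Dc DV xD]] := lx _ (@fwd_continuous _ h x V hxV).
exists (h @` D); split; first exact: connected_fwd.
- move=> _ [y Dy <-]; have [Vy yx] := DV y Dy.
  by split=> // /fwd_inj.
- apply: filterS (nbhs_fwd h xD) => y /= [hyx|Dy].
    by left; rewrite -hyx bwdK.
  by right; exists (bwd h y) => //; rewrite bwdK.
Qed.

Lemma open_component (x : X) : (forall y, locally_connected_at y) ->
  open (connected_component [set: X] x).
Proof.
move=> lc; rewrite openE => y xy; have [W [yW Wc _]] := lc y _ filterT.
apply: filterS (yW); rewrite (same_connected_component xy).
exact: connected_component_max (nbhs_singleton yW) _ Wc.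
Qed.

Hypothesis hX : hausdorff_space X.

Lemma open_setD1 (S : set X) (p : X) : open S -> open (S `\ p).
Proof.
move=> So; rewrite setDE; apply: openI => //; apply: closed_openC.
exact/accessible_closed_set1/hausdorff_accessible.
Qed.

(** In a splitting of the punctured set, the connected punctured neighborhood
    of [p] lies on one side; adding [p] to this side gives a splitting of the
    whole set. *)
Lemma connected_setD1 (S : set X) (p : X) :
  open S -> connected S -> nonseparating_at p -> connected (S `\ p).
Proof.
move=> So Sc nsp; have [Sp|nSp] := pselect (S p); last first.
  by rewrite not_setD1.
have Spo := open_setD1 p So.
apply: connected_by_open_splits => O1 O2 O1o O2o cover disj ne.
have [D [Dc DS pD]] := nsp S (open_nbhs_nbhs (conj So Sp)).
have Np : (p |` D)° p by [].
have No := @open_interior _ (p |` D).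
have [meet|nmeet] := pselect (D `&` O1 !=set0).
  have DO1 : D `<=` O1.
    apply: (connected_open_split Dc O1o O2o) => // x; first by move/DS/cover.
    by move=> [[Dx O1x] O2x]; apply: (disj x); split=> //; split=> //; exact: DS.
  suff SO : S `<=` (O1 `|` (p |` D)°).
    move=> x [Sx xp]; have [//|/interior_subset[//|]] := SO x Sx; exact: DO1.
  apply: (@connected_open_split S _ (O2 `&` (S `\ p))) => //.
  - exact: openU.
  - exact: openI.
  - move=> x Sx; have [->|xp] := pselect (x = p); first by left; right.
    by have [||O2x] := cover x; [|left; left|right].
  - move=> x [[Sx [ O1x|/interior_subset[->|/DO1 O1x]]] [ O2x [_ xp]]].
    + exact: (disj x).
    + by case: xp.
    + exact: (disj x).
  - by exists p; split=> //; right.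
have [x [[Sx xp] O1x]] := ne.
suff SO : S `<=` O1 `&` (S `\ p) by have [_ [_ []]] := SO p Sp.
apply: (@connected_open_split S _ (O2 `|` (p |` D)°)) => //.
- exact: openI.
- exact: openU.
- move=> y Sy; have [->|yp] := pselect (y = p); first by right; right.
  by have [||O2y] := cover y; [|left|right; left].
- move=> y [[_ [ O1y [Sy yp]]] [ O2y|/interior_subset[//|Dy]]].
    exact: (disj y).
  by apply: nmeet; exists y.
- by exists x.
Qed.

Lemma connected_setD_seq (S : set X) (L : seq X) :
  (forall x, nonseparating_at x) -> open S -> connected S ->
  open (S `\` [set` L]) /\ connected (S `\` [set` L]).
Proof.
move=> ns So Sc; elim: L => [|l L [IHo IHc]].
  by rewrite (_ : [set` [::]] = set0) ?setD0 //; apply/seteqP; split.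
have -> : S `\` [set` l :: L] = (S `\` [set` L]) `\ l.
  apply/seteqP; split=> x /=; rewrite in_cons.
    by move=> [Sx /negP]; rewrite negb_or => /andP[/eqP xl /negP xL].
  move=> [[Sx xL] xl]; split=> //; apply/negP; rewrite negb_or.
  by apply/andP; split; [exact/eqP|exact/negP].
by split; [exact: open_setD1 | exact: connected_setD1].
Qed.

Hypothesis slh : forall x : X, strongly_locally_homogeneous x.

(** Strong local homogeneity makes the orbits of the homeomorphisms supported in
    [S] open, and they partition [S]. *)
Lemma connected_open_transitive (S : set X) (a b : X) :
  open S -> connected S -> S a -> S b ->
  exists g : selfhomeo X, supported S g /\ g a = b.
Proof.
move=> So Sc Sa Sb.
pose orb := [set y | S y /\ exists g : selfhomeo X, supported S g /\ g a = y].
have local y : S y -> exists2 W, nbhs y W & forall z w, W z -> W w ->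
    [/\ S z, S w & orb z -> orb w].
  move=> Sy; have [W yW WP] := slh (open_nbhs_nbhs (conj So Sy)).
  exists (W `&` S); first by apply: filterI => //; exact: open_nbhs_nbhs.
  move=> z w [Wz Sz] [Ww Sw]; split=> // -[_ [g [gS gz]]]; split=> //.
  have [k [kS kz]] := WP z w Wz Ww.
  by exists (homeo_comp k g); split; [exact: supported_comp|rewrite /= gz].
suff /(_ b Sb)[_ //] : S `<=` orb.
apply: (@connected_open_split S orb (S `\` orb)) => //.
- rewrite openE => y yorb; have [Sy _] := yorb.
  have [W yW WP] := local y Sy; apply: filterS (yW) => z Wz.
  by have [_ _] := WP y z (nbhs_singleton yW) Wz; apply.
- rewrite openE => y [Sy nyorb].
  have [W yW WP] := local y Sy; apply: filterS (yW) => z Wz.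
  have [Sz _ h] := WP z y Wz (nbhs_singleton yW); split=> // zorb.
  by apply: nyorb; exact: h.
- by move=> y Sy; have [|ny] := pselect (orb y); [left|right].
- by move=> y [[_ yo] [_]].
- by exists a; split=> //; split=> //; exists (homeo_id X).
Qed.

(** The points are moved one at a time, with support away from the targets
    already reached.  No point is in the way, since the points still to be
    moved need not be fixed. *)
Lemma extend_finite (S : set X) (T : eqType) (s : seq T) (x y : T -> X) :
  (forall x, nonseparating_at x) -> open S -> connected S ->
  uniq s -> (forall t, S (x t)) -> (forall t, S (y t)) ->
  {in s &, injective x} -> {in s &, injective y} ->
  exists g : selfhomeo X, supported S g /\ forall t, t \in s -> g (x t) = y t.
Proof.
move=> ns So Sc + Sx Sy; elim: s => [|t s IH].
  by move=> *; exists (homeo_id X).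
rewrite cons_uniq => /andP[ts us] xinj yinj.
have [||g [gS gP]] := IH us.
- by move=> u v us1 vs1; apply: xinj; rewrite in_cons ?us1 ?vs1 orbT.
- by move=> u v us1 vs1; apply: yinj; rewrite in_cons ?us1 ?vs1 orbT.
have [To Tc] := connected_setD_seq [seq y u | u <- s] ns So Sc.
have [||k [kT kxy]] := connected_open_transitive (a := g (x t)) (b := y t) To Tc.
- split; first exact/(supported_stable _ gS).
  move=> /mapP[u us1]; rewrite -gP // => /fwd_inj xtu.
  by move: ts; rewrite (xinj t u) ?mem_head ?us1 // in_cons us1 orbT.
- split=> // /mapP[u us1] ytu.
  by move: ts; rewrite (yinj t u) ?mem_head ?us1 // in_cons us1 orbT.
exists (homeo_comp k g); split.
  apply: supported_comp => //; apply: (supportedS _ kT); exact: subDsetl.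
move=> u; rewrite in_cons => /orP[/eqP->//|us1] /=.
rewrite gP // kT // => -[_]; apply; exact: map_f.
Qed.

Lemma restrict_homeo (S : set X) (g : selfhomeo X) : supported S g ->
  exists2 h : set_type S -> set_type S, homeomorphism h &
    forall z, val (h z) = g (val z).
Proof.
move=> gS.
have Sg (f : selfhomeo X) (fS : supported S f) (z : set_type S) :
  f (val z) \in S by apply/mem_set/(supported_stable _ fS); exact: set_valP.
pose res f (fS : supported S f) (z : set_type S) : set_type S :=
  exist _ (f (val z)) (Sg f fS z).
have resc f fS : continuous (res f fS).
  apply: continuous_into_subspace => z.
  apply: (@continuous_comp _ _ _ (fun z : set_type S => val z) f).
    exact: set_val_continuous.
  exact: fwd_continuous.
exists (res g gS) => //; split; first exact: resc.
exists (res _ (supported_inv gS)); split; first exact: resc.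
- by move=> z; apply: val_inj; rewrite /= fwdK.
- by move=> z; apply: val_inj; rewrite /= bwdK.
Qed.

Lemma open_connected_strongly_homogeneous (S : set X) (n : nat) :
  (forall x, nonseparating_at x) -> open S -> connected S ->
  strongly_homogeneous n (set_type S).
Proof.
move=> ns So Sc A B f An Bn [fAB finj _].
have /finite_seqP[s As] : finite_set A by apply/finite_setP; exists n.
have [|||||g [gS gP]] := @extend_finite S (set_type S) (undup s)
    (fun z => val z) (fun z => val (f z)) ns So Sc.
- exact: undup_uniq.
- by move=> z; exact: set_valP.
- by move=> z; exact: set_valP.
- by move=> u v _ _; exact: val_inj.
- move=> u v; rewrite !mem_undup => us vs /val_inj; apply: finj;
  by rewrite inE As.
have [h hh hg] := restrict_homeo gS; exists h; split=> // z Az.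
by apply: val_inj; rewrite hg gP // mem_undup; move: Az; rewrite As.
Qed.

End connectedness.

(** * Conical charts *)

Section cone_chart.
Context (R : realType) (Y X : topologicalType).

(** An open embedding of the open cone, described on the cylinder of which the
    cone is a quotient; the set [O] in [chart_open] is the preimage of an open
    set of the cone. *)
Record cone_chart (k : cylinder R Y -> X) : Prop := ConeChart {
  chart_continuous : continuous k;
  chart_eq : forall p q, k p = k q <-> cone_rel p q;
  chart_open : forall O, open O -> (forall p q, cone_rel p q -> O p -> O q) ->
    open (k @` O) }.

Lemma open_cone_chart (U : set X) : open U ->
  homeomorphic U (open_cone R Y) ->
  exists k, cone_chart k /\ range k = U.
Proof.
move=> Uo [f [fc [g [gc fgK gfK]]]].
pose pr (p : cylinder R Y) : open_cone R Y := \pi_(open_cone R Y)%qT p.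
have prc : continuous pr by exact: pi_continuous.
have pr_eq p q : pr p = pr q <-> cone_rel p q.
  split=> [/eqmodP//|pq]; exact/eqmodP.
have pr_surj c : exists p, pr p = c by exists (repr c); exact: reprK.
exists (fun p => val (g (pr p))); split; first split.
- move=> p; apply: (@continuous_comp _ _ _ (fun p => g (pr p)) (fun z : set_type U => val z)).
    apply: (@continuous_comp _ _ _ pr g); [exact: prc | exact: gc].
  exact: set_val_continuous.
- move=> p q; rewrite -pr_eq; split=> [/val_inj h|->//].
  by rewrite -[pr p]gfK h gfK.
- move=> O Oo Osat.
  have : open (f @^-1` (pr @` O)).
    apply: open_comp => [x _|]; first exact: fc.
    rewrite (_ : open _ = open (pr @^-1` (pr @` O)))//.
    suff -> : pr @^-1` (pr @` O) = O by [].
    apply/seteqP; split=> [p [q Oq /pr_eq qp]|p Op]; last by exists p.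
    exact: Osat Oq.
  move=> [V Vo Vf].
  suff -> : [set val (g (pr p)) | p in O] = V `&` U by exact: openI.
  apply/seteqP; split=> [_ [p Op <-]|x [Vx Ux]].
    split; last exact: set_valP.
    suff : (val @^-1` V) (g (pr p)) by [].
    by rewrite Vf /= gfK; exists p.
  have : (val @^-1` V) (exist _ x (mem_set Ux) : set_type U) by [].
  by rewrite Vf => -[p Op] pf; exists p => //; rewrite pf fgK.
- apply/seteqP; split=> [_ [p _ <-]|x Ux]; first exact: set_valP.
  have [p pf] := pr_surj (f (exist _ x (mem_set Ux))).
  by exists p => //; rewrite pf fgK.
Qed.

End cone_chart.

Section ray.
Context (R : realType).

Definition ray : topologicalType := set_type [set t : \bar R | (0 < t)%E].

Definition infty : ray := exist _ +oo%E (mem_set (ltry 0 : (0 < +oo)%E)).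

Lemma expR_pos_ereal (s : R) : (0 < (expR s)%:E)%E.
Proof. by rewrite lte_fin expR_gt0. Qed.

(** The logarithmic coordinate of the finite points of the ray.  It ranges over
    the whole real line, the vertex of the cone being at plus infinity. *)
Definition expray (s : R) : ray :=
  exist _ (expR s)%:E (mem_set (expR_pos_ereal s)).

Lemma rayP (t : ray) : t = infty \/ exists s, t = expray s.
Proof.
have := set_valP t; case E : (val t) => [x| |] //= x0; last first.
  by left; apply: val_inj.
by right; exists (ln x); apply: val_inj; rewrite E /= lnK.
Qed.

Lemma expray_continuous : continuous expray.
Proof.
apply: continuous_into_subspace => s A /=.
move=> /nbhs_EFin; exact: continuous_expR.
Qed.

Lemma nbhs_expray (s : R) (A : set ray) :
  nbhs (expray s) A <-> nbhs s (expray @^-1` A).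
Proof.
split=> [|sA]; first exact: expray_continuous.
apply/nbhs_set_typeP.
exists [set t | exists u, t = (expR u)%:E /\ A (expray u)].
  apply/nbhs_EFin.
  have h : nbhs (expR s) (@ln R @^-1` (expray @^-1` A)).
    by apply: continuous_ln; rewrite ?expR_gt0 // expRK.
  have p : \forall x \near expR s, 0 < x.
    by apply: lt_nbhsr; rewrite expR_gt0.
  near=> x; exists (ln x); split; first by rewrite lnK // posrE; near: x.
  by near: x.
move=> w [u [wu Au]]; suff -> : w = expray u by [].
exact: val_inj.
Unshelve. all: by end_near. Qed.

Lemma nbhs_infty (A : set ray) :
  nbhs infty A <-> A infty /\ exists M, forall s, M < s -> A (expray s).
Proof.
split=> [iA|[Ai [M MA]]].
  split; first exact: nbhs_singleton.
  have [V [M [_ MV]] VA] := (nbhs_set_typeP _ _).1 iA.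
  exists M => s Ms; apply: VA; apply: MV; rewrite lte_fin.
  by have := expR_ge1Dx s; lra.
apply/nbhs_set_typeP; exists [set t | ((expR M)%:E < t)%E].
  exact: nbhs_open_ereal_pinfty.
move=> w; have [->//|[s -> /=]] := rayP w.
by rewrite lte_fin ltr_expR; exact: MA.
Qed.

Definition above (r : R) : set ray := [set t | ((expR r)%:E < val t)%E].

Lemma above_expray r s : above r (expray s) <-> r < s.
Proof. by rewrite /above /= lte_fin ltr_expR. Qed.

Lemma above_infty r : above r infty.
Proof. by rewrite /above /= ltry. Qed.

Lemma open_above r : open (above r).
Proof.
rewrite openE => t; have [-> _|[s ->] /above_expray rs] := rayP t.
  apply/nbhs_infty; split; first exact: above_infty.
  by exists r => s /above_expray.
apply/nbhs_expray; apply: filterS (lt_nbhsr rs) => u ru.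
exact/above_expray.
Qed.

(** The identity up to [r], and the dilation of center [r] and ratio [l] beyond
    [r]; the inverse has the same form, with the inverse ratio. *)
Definition stretchR (l r s : R) : R := s + (l - 1) * Num.max 0 (s - r).

(** In the first case [x] is positive. *)
Definition stretch (l r : R) (t : ray) : ray :=
  if val t is (x%:E)%E then expray (stretchR l r (ln x)) else infty.

Lemma stretch_expray l r s : stretch l r (expray s) = expray (stretchR l r s).
Proof. by rewrite /stretch /= expRK. Qed.

Lemma stretch_infty l r : stretch l r infty = infty.
Proof. by []. Qed.

Lemma stretchRK l r : 0 < l -> cancel (stretchR l r) (stretchR l^-1 r).
Proof.
move=> l0 s; rewrite /stretchR.
have li : l * l^-1 = 1 by rewrite divff // gt_eqF.
case: (boolP (s - r <= 0)) => [sr|]; last rewrite -ltNge => sr.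
  by rewrite !(max_l sr) !mulr0 !addr0 (max_l sr) mulr0 addr0.
rewrite (max_r (ltW sr)).
have -> : s + (l - 1) * (s - r) - r = l * (s - r) by ring.
rewrite max_r ?mulr_ge0 ?ltW //.
transitivity (r + l * l^-1 * (s - r)); first by ring.
by rewrite li; ring.
Qed.

Lemma stretchK l r : 0 < l -> cancel (stretch l r) (stretch l^-1 r).
Proof.
move=> l0 t; have [->//|[s ->]] := rayP t.
by rewrite !stretch_expray stretchRK.
Qed.

Lemma stretch_id l r t : ~ above r t -> stretch l r t = t.
Proof.
have [->|[s ->]] := rayP t; first by case; exact: above_infty.
move=> /above_expray/negP; rewrite -leNgt => sr.
by rewrite stretch_expray /stretchR max_l ?subr_le0 // mulr0 addr0.
Qed.

Lemma stretchR_continuous l r : continuous (stretchR l r).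
Proof.
have mc : continuous ((fun=> 0) \max (fun s : R => s - r)).
  move=> s; apply: continuous_max; first exact: cvg_cst.
  by apply: cvgB; [exact: cvg_id|exact: cvg_cst].
move=> s; apply: cvgD; first exact: cvg_id.
by apply: cvgM; [exact: cvg_cst|exact: mc].
Qed.

Lemma stretch_continuous (l r : R) : 0 < l -> continuous (stretch l r).
Proof.
move=> l0 t; have [->|[s ->]] := rayP t => A /=.
  rewrite stretch_infty => /nbhs_infty[Ai [M MA]].
  apply/nbhs_infty; split=> //; exists (Num.max r (r + (M - r) / l)) => s.
  rewrite gt_max => /andP[rs Ms].
  rewrite -[_ (expray s)]/(A (stretch l r (expray s))) stretch_expray; apply: MA.
  rewrite /stretchR max_r ?subr_ge0 ?ltW //.
  have : (M - r) / l < s - r by lra.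
  by rewrite ltr_pdivrMr //; lra.
rewrite stretch_expray => /nbhs_expray sA; apply/nbhs_expray.
have : nbhs s (stretchR l r @^-1` (expray @^-1` A)).
  exact: stretchR_continuous.
apply: filterS => u ru.
by suff : A (stretch l r (expray u)) by []; rewrite stretch_expray.
Qed.

End ray.

(** * The vertex of a cone *)

Lemma connected_adjoin_closure (X : topologicalType) (B : set X) (v : X) :
  connected B -> closure B v -> connected (v |` B).
Proof.
move=> Bc vB; apply: connected_by_open_splits => O1 O2 O1o O2o cover disj ne.
have split1 : B `&` O1 !=set0 -> B `<=` O1.
  move=> ne1; apply: (connected_open_split Bc O1o O2o) => //.
    by move=> x Bx; apply: cover; right.
  by move=> x [[Bx O1x] O2x]; apply: (disj x); split=> //; split=> //; right.
have [ O1v|O2v] := cover v (or_introl erefl).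
  have BO1 : B `<=` O1 by apply: split1; apply: vB; exact: open_nbhs_nbhs.
  by move=> x [->|/BO1].
have [x [[xv|Bx] O1x]] := ne.
  by case: (disj v); split=> //; split; [left | rewrite -xv].
have BO1 : B `<=` O1 by apply: split1; exists x.
have [y [By O2y]] := vB _ (open_nbhs_nbhs (conj O2o O2v)).
by case: (disj y); split=> //; split; [right | exact: BO1].
Qed.

Lemma continuous_pair (S T U : topologicalType) (f : S -> T) (g : S -> U) :
  continuous f -> continuous g -> continuous (fun x => (f x, g x)).
Proof.
move=> fc gc x A [[B C] [/= xB xC] BC].
suff : nbhs x [set z | A (f z, g z)] by [].
have xBC : nbhs x (f @^-1` B `&` g @^-1` C).
  by apply: filterI; [exact: fc | exact: gc].
by apply: filterS xBC => z [Bz Cz]; exact: (BC (f z, g z)).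
Qed.

Lemma connected_star (X : topologicalType) (D : set X) (b : X) :
  (forall x, D x -> exists C, [/\ connected C, C `<=` D, C b & C x]) ->
  connected D.
Proof.
move=> star; suff -> : D = connected_component D b by exact: component_connected.
apply/seteqP; split=> [x Dx|]; last exact: connected_component_sub.
by have [C [Cc CD Cb Cx]] := star x Dx; exists C.
Qed.

Section cone_geometry.
Context (R : realType) (Y X : topologicalType) (k : cylinder R Y -> X).
Hypotheses (kP : cone_chart k) (Y_compact : compact [set: Y]).
Hypothesis hX : hausdorff_space X.
Variable y0 : Y.

Local Notation infty := (infty R).
Local Notation v := (k (y0, infty)).

Lemma cone_relP (p q : cylinder R Y) :
  cone_rel p q <-> p = q \/ (p.2 = infty /\ q.2 = infty).
Proof.
rewrite /cone_rel; split=> [/orP[/eqP->|/andP[/eqP p2 /eqP q2]]|[->|[p2 q2]]].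
- by left.
- by right; split; apply: val_inj.
- by rewrite eqxx.
- by rewrite p2 q2 !eqxx orbT.
Qed.

Lemma chart_vertex (y : Y) : k (y, infty) = v.
Proof. by apply/(chart_eq kP)/cone_relP; right. Qed.

(** The tube lemma: as the base is compact, a neighborhood of the vertex
    contains all the points of the cone beyond some level. *)
Lemma near_vertex (V : set X) : nbhs v V ->
  exists r, forall p : cylinder R Y, above r p.2 -> V (k p).
Proof.
move=> vV.
have loc y : [set: Y] y ->
    \forall y' \near y & t \near infty, V (k (y', t)).
  move=> _; have : nbhs ((y, infty) : cylinder R Y) (k @^-1` V).
    by apply: (chart_continuous kP); rewrite chart_vertex.
  move=> [[A B] /= [yA iB] AB]; exists (A, B) => // -[a b] [Aa Bb].
  exact: (AB (a, b)).
have cov := (compact_near_coveringP _).1 Y_compact _ _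
  (fun t y => V (k (y, t))) (nbhs_filter infty) loc.
have [Vi [r Vr]] := (nbhs_infty _).1 cov; exists r => -[y t] /=.
have [->|[s ->]] := rayP t; first by move=> _; exact: Vi.
by move=> /above_expray rs; exact: Vr.
Qed.

Lemma open_cone_above r : open (k @` [set p | above r p.2]).
Proof.
apply: (chart_open kP).
  by apply: open_comp => [p _|]; [exact: cvg_snd | exact: open_above].
by move=> p q /cone_relP[->//|[_ /= ->]] _; exact: above_infty.
Qed.

Lemma nbhs_vertex_above r : nbhs v (k @` [set p | above r p.2]).
Proof.
apply: open_nbhs_nbhs; split; first exact: open_cone_above.
by exists (y0, infty) => //; exact: above_infty.
Qed.

(** The upper part of the cone together with the vertex is closed in the whole
    space, not only in the chart: its points near the vertex are separated
    from [x] by the Hausdorff property, and the others are in a compact set. *)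
Lemma nbhs_outside r x : ~ range k x ->
  nbhs x (~` (k @` [set p | above r p.2])).
Proof.
move=> nkx; have xv : x != v by apply/eqP => xv; apply: nkx; rewrite xv; exists (y0, infty).
have := hX; rewrite open_hausdorff => /(_ _ _ xv)[[A B] /= [xA vB] [Ao Bo AB]].
have [|M MB] := @near_vertex B.
  by apply: open_nbhs_nbhs; split=> //; exact: set_mem vB.
have Kc : compact (k @` ([set: Y] `*` (@expray R @` `[r, M]))).
  apply: continuous_compact.
    by apply: continuous_subspaceT; exact: chart_continuous kP.
  apply: compact_setX => //; apply: continuous_compact; last exact: segment_compact.
  by apply: continuous_subspaceT; exact: expray_continuous.
have Kcl := compact_closed hX Kc.
have : nbhs x (A `&` ~` (k @` ([set: Y] `*` (@expray R @` `[r, M])))).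
  apply: filterI; first by apply: open_nbhs_nbhs; split=> //; exact: set_mem xA.
  apply: open_nbhs_nbhs; split; first exact: closed_openC.
  by move=> [p _ px]; apply: nkx; exists p.
apply: filterS => z [Az nKz] [[y t] /= rt pz].
have BM : above M t -> False.
  move=> Mt; have : (A `&` B) z by split=> //; rewrite -pz; exact: MB.
  by move/eqP : AB => ->.
have [ti|[s ts]] := rayP t; first by apply: BM; rewrite ti; exact: above_infty.
apply: nKz; exists (y, t) => //; split=> //; exists s => //.
rewrite /= in_itv /=; apply/andP; split.
  by move: rt; rewrite ts => /above_expray/ltW.
by rewrite leNgt; apply/negP => Ms; apply: BM; rewrite ts; exact/above_expray.
Qed.

Definition push (l r : R) (x : X) : X :=
  if pselect (exists p, k p = x) is left e
  then k ((projT1 (cid e)).1, stretch l r (projT1 (cid e)).2) else x.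

Lemma push_chart l r p : push l r (k p) = k (p.1, stretch l r p.2).
Proof.
rewrite /push; case: pselect => [e|]; last by case; exists p.
case: cid => q /= /(chart_eq kP)/cone_relP[->//|[q2 p2]].
by rewrite q2 p2 !stretch_infty !chart_vertex.
Qed.

Lemma push_out l r x : ~ (k @` [set p | above r p.2]) x -> push l r x = x.
Proof.
move=> nx; have [[p px]|nkx] := pselect (exists p, k p = x); last first.
  by rewrite /push; case: pselect.
rewrite -px push_chart stretch_id -?surjective_pairing // => rp.
by apply: nx; exists p.
Qed.

Lemma push_continuous l r : 0 < l -> continuous (push l r).
Proof.
move=> l0 x; have [[p px]|nkx] := pselect (exists p, k p = x); last first.
  have nx : ~ range k x by move=> [p _ px]; apply: nkx; exists p.
  move=> A; rewrite push_out; last by move=> [p _ px]; apply: nkx; exists p.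
  move=> xA; apply: filterS (filterI xA (nbhs_outside r nx)) => z [Az nz].
  by rewrite /preimage /= push_out.
move=> A; rewrite -px nbhsE => -[B [Bo Bx] BA].
pose sp (q : cylinder R Y) : cylinder R Y := (q.1, stretch l r q.2).
have spc : continuous sp.
  apply: continuous_pair => q; first exact: cvg_fst.
  apply: (@continuous_comp _ _ _ (fun q : cylinder R Y => q.2) (stretch l r)).
    exact: cvg_snd.
  exact: stretch_continuous.
have : open (k @` ((k \o sp) @^-1` B)).
  apply: (chart_open kP).
    apply: open_comp => // q _; apply: continuous_comp; first exact: spc.
    exact: chart_continuous kP _.
  move=> q q' /cone_relP[->//|[q2 q'2]].
  by rewrite /preimage /sp /= q2 q'2 !stretch_infty !chart_vertex.
move=> Uo; apply: filterS (open_nbhs_nbhs (conj Uo _)); last first.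
  by exists p => //; rewrite /= /sp -push_chart.
move=> _ [q Bq <-]; apply: BA.
by rewrite push_chart.
Qed.

Lemma pushK l r : 0 < l -> cancel (push l r) (push l^-1 r).
Proof.
move=> l0 x; have [[p px]|nkx] := pselect (exists p, k p = x).
  by rewrite -px !push_chart /= stretchK // -surjective_pairing.
by rewrite !push_out // => -[p _ px]; apply: nkx; exists p.
Qed.

Lemma pushable_vertex : pushable v.
Proof.
move=> V vV; have [r rV] := near_vertex vV.
exists (k @` [set p | above (r + 1) p.2]); first exact: nbhs_vertex_above.
move=> _ [p rp <-] N vN; have [M MN] := near_vertex vN.
(* Beyond level [r + 1] the stretched level is at least [r + l], which is more
   than [M]. *)
pose l := Num.max 1 (M - r + 1).
have l1 : 1 <= l by rewrite le_max lexx.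
have lM : M - r + 1 <= l by rewrite le_max lexx orbT.
have l0 : 0 < l by lra.
have l'0 : 0 < l^-1 by rewrite invr_gt0.
have lK : cancel (push l^-1 r) (push l r).
  by move=> x; rewrite -{1}[l]invrK pushK.
exists (SelfHomeo (@push_continuous l r l0) (@push_continuous l^-1 r l'0)
  (@pushK l r l0) lK).
split=> [u nVu|] /=.
  by apply: push_out => -[q rq qu]; apply: nVu; rewrite -qu; exact: rV.
rewrite push_chart; apply: MN => /=.
have [->|[s ps]] := rayP p.2; first by rewrite stretch_infty; exact: above_infty.
move: rp; rewrite /= ps => /above_expray rs.
rewrite stretch_expray; apply/above_expray.
rewrite /stretchR max_r; last by lra.
have : l * 1 <= l * (s - r) by rewrite ler_pM2l //; lra.
lra.
Qed.

(** All rays end at the vertex. *)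
Lemma locally_connected_vertex : locally_connected_at v.
Proof.
move=> V vV; have [r rV] := near_vertex vV.
exists (k @` [set p | above r p.2]); split; first exact: nbhs_vertex_above.
  apply: (@connected_star _ _ v) => _ [[y t] /= rt <-].
  pose B := (fun s => k (y, expray s)) @` `]r, +oo[.
  have Bc : connected B.
    apply: connected_continuous_connected.
      by apply/connected_intervalP; exact: interval_is_interval.
    apply: continuous_subspaceT => s.
    apply: (@continuous_comp _ _ _ (fun s => (y, expray s) : cylinder R Y) k); last first.
      exact: chart_continuous kP _.
    apply: (@continuous_pair _ _ _ (fun=> y) (@expray R)) => ?.
      exact: cvg_cst.
    exact: expray_continuous.
  exists (v |` B); split; [|move=> _ [->|[s rs <-]]|by left|].
  - apply: connected_adjoin_closure => // N /near_vertex[M MN].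
    exists (k (y, expray (Num.max r M + 1))); split.
      exists (Num.max r M + 1) => //.
      by rewrite /= in_itv /= andbT ltr_pwDr // le_max lexx.
    by apply: MN; apply/above_expray; rewrite ltr_pwDr // le_max lexx orbT.
  - by exists (y0, infty) => //; exact: above_infty.
  - exists (y, expray s) => //; apply/above_expray.
    by move: rs; rewrite /= in_itv /= andbT.
  - have [->|[s ts]] := rayP t; first by left; rewrite chart_vertex.
    right; exists s; last by rewrite ts.
    by move: rt; rewrite ts => /above_expray; rewrite /= in_itv /= andbT.
by move=> _ [p rp <-]; exact: rV.
Qed.

End cone_geometry.

(** * The cone away from its vertex *)

Lemma open_product (S T : topologicalType) (A : set S) (B : set T) :
  open A -> open B -> open (A `*` B).
Proof.
move=> Ao Bo; rewrite openE => -[a b] [/= Aa Bb].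
by exists (A, B) => //; split; apply: open_nbhs_nbhs.
Qed.

Section open_product.
Context (R : realType) (Y X : topologicalType) (j : Y * R -> X).
Hypotheses (j_continuous : continuous j) (j_inj : injective j).
Hypothesis j_open : forall O, open O -> open (j @` O).

Lemma open_embedding_retraction (p0 : Y * R) : exists c : X -> Y * R,
  cancel j c /\ forall p, {for j p, continuous c}.
Proof.
have [c cP] : exists c : X -> Y * R, forall x, range j x -> j (c x) = x.
  have h x : exists p, range j x -> j p = x.
    by have [[p _ px]|nx] := pselect (range j x); [exists p|exists p0].
  by have [c cP] := choice h; exists c.
have jK : cancel j c by move=> p; apply: j_inj; rewrite cP //; exists p.
exists c; split=> // p A; rewrite jK => pA.
apply: (filterS (P := j @` A°)); last first.
  apply: open_nbhs_nbhs; split; first by apply: j_open; exact: open_interior.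
  by exists p.
by move=> _ [q Aq <-]; rewrite /preimage /= jK; exact: interior_subset.
Qed.

(** Removing a point from a product of two connected spaces with more than one
    point leaves it connected: the slices avoiding the point still hang
    together. *)
Lemma connected_punctured_strip (A : set Y) (I : set R) (y y' : Y) (s s0 : R) :
  connected A -> connected I -> A y' -> y' <> y -> I s0 -> s0 <> s ->
  connected ((A `*` I) `\ (y, s)).
Proof.
move=> Ac Ic Ay' y'y Is0 s0s.
have vert u : connected ((fun t => (u, t)) @` I : set (Y * R)).
  apply: connected_continuous_connected => //; apply: continuous_subspaceT.
  by apply: continuous_pair => ?; [exact: cvg_cst | exact: cvg_id].
have horz t : connected ((fun u => (u, t)) @` A : set (Y * R)).
  apply: connected_continuous_connected => //; apply: continuous_subspaceT.
  by apply: continuous_pair => ?; [exact: cvg_id | exact: cvg_cst].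
have cross t : I t -> connected
    (((fun t => (y', t)) @` I) `|` ((fun u => (u, t)) @` A) : set (Y * R)).
  by move=> It; apply: connectedU => //; exists (y', t); split; [exists t|exists y'].
have vert_sub u : A u -> u <> y ->
    (fun t => (u, t)) @` I `<=` (A `*` I) `\ (y, s).
  by move=> Au uy _ [t It <-]; split=> // -[].
have horz_sub t : I t -> t <> s ->
    (fun u => (u, t)) @` A `<=` (A `*` I) `\ (y, s).
  by move=> It ts _ [u Au <-]; split=> // -[].
apply: (@connected_star _ _ (y', s0)) => -[u t] [[/= Au It] ut].
have [ts|ts] := pselect (t = s); last first.
  exists (((fun t => (y', t)) @` I) `|` ((fun u => (u, t)) @` A)); split.
  - exact: cross.
  - by rewrite subUset; split; [exact: vert_sub | exact: horz_sub].
  - by left; exists s0.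
  - by right; exists u.
have uy : u <> y by move=> uy; apply: ut; rewrite uy ts.
exists ((((fun t => (y', t)) @` I) `|` ((fun u => (u, s0)) @` A)) `|`
  ((fun t => (u, t)) @` I)); split.
- apply: connectedU => //; last exact: cross.
  by exists (u, s0); split; [right; exists u | exists s0].
- rewrite !subUset; split; first split.
  + exact: vert_sub.
  + exact: horz_sub.
  + exact: vert_sub.
- by left; left; exists s0.
- by right; exists t.
Qed.

(** Local connectedness provides a small connected neighborhood [W] of the
    point.  It need not be a product, but the product of its projection to [Y]
    with an interval is still small, contains [W], and is a product of
    connected sets, the first of which has a second point because [y] is not
    isolated. *)
Lemma nonseparating_product (y : Y) (s : R) :
  locally_connected_at (j (y, s)) -> ~ nbhs y [set y] ->
  nonseparating_at (j (y, s)).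
Proof.
move=> lc isol V jV.
have [c [jK cc]] := open_embedding_retraction (y, s).
have [[A B] /= [yA sB] ABV] : nbhs (y, s) (j @^-1` V) by exact: j_continuous.
have [e /= e0 eB] := (nbhs_ballP _ _).1 sB.
pose I : set R := `]s - e, s + e[%classic.
have IE t : I t -> B t.
  rewrite /I /= in_itv /= => /andP[t1 t2]; apply: eB.
  by rewrite /ball /= ltr_norml; apply/andP; split; lra.
have Is : I s by rewrite /I /= in_itv /=; apply/andP; split; lra.
have Is0 : I (s + e / 2) by rewrite /I /= in_itv /=; apply/andP; split; lra.
have Io : open I by exact: itv_open.
have Ic : connected I by apply/connected_intervalP; exact: interval_is_interval.
have No : open (j @` (A° `*` I)).
  by apply: j_open; apply: open_product => //; exact: open_interior.
have [|W [xW Wc WN]] := lc (j @` (A° `*` I)).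
  by apply: open_nbhs_nbhs; split=> //; exists (y, s).
pose WY := (fun x => (c x).1) @` W.
have WYc : connected WY.
  apply: connected_continuous_connected => //.
  apply: continuous_in_subspaceT => x /set_mem /WN[p _ <-].
  apply: (@continuous_comp _ _ _ c fst); [exact: cc | exact: cvg_fst].
have WYA u : WY u -> A u.
  by move=> [_ /WN[[a t] [Aa _] <-] <-]; rewrite jK; exact: interior_subset.
have [y' [WYy' y'y]] : exists y', WY y' /\ y' <> y.
  have [[A2 B2] /= [yA2 sB2] AB2] : nbhs (y, s) (j @^-1` W) by exact: j_continuous.
  apply: contrapT => no; apply: isol; apply: filterS yA2 => u A2u.
  apply: contrapT => uy; apply: no; exists u; split=> //.
  exists (j (u, s)); last by rewrite jK.
  by apply: (AB2 (u, s)); split=> //; exact: nbhs_singleton.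
exists (j @` ((WY `*` I) `\ (y, s))); split.
- apply: connected_continuous_connected; last first.
    by apply: continuous_subspaceT; exact: j_continuous.
  apply: (connected_punctured_strip WYc Ic WYy' y'y Is0); lra.
- move=> _ [[u t] [[/= WYu It] ut] <-]; split; last by move/j_inj.
  by apply: (ABV (u, t)); split; [exact: WYA | exact: IE].
- apply: filterS (xW) => w Ww; have [[u t] [/= Au It] uw] := WN w Ww.
  have [ut|ut] := pselect ((u, t) = (y, s)); first by left; rewrite -ut.
  right; exists (u, t) => //; split=> //; split=> //=.
  by exists w => //; rewrite -uw jK.
Qed.

Lemma isolated_euclidean (y : Y) : nbhs y [set y] ->
  exists (U : set X) (V : set 'rV[R]_1),
    [/\ open U, U (j (y, 0)), open V & homeomorphic U V].
Proof.
move=> yy; have [c [jK cc]] := open_embedding_retraction (y, 0).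
have Uo : open (j @` ([set y] `*` [set: R])).
  apply: j_open; apply: open_product; last exact: openT.
  by rewrite openE => _ ->.
exists (j @` ([set y] `*` [set: R])), setT; split => //.
- by exists (y, 0).
- exact: openT.
set U := j @` _.
have const_c : continuous (fun t : R => const_mx t : 'rV[R]_1).
  move=> t A /nbhs_ballP[e /= e0 eA]; apply/nbhs_ballP; exists e => // u tu.
  by apply: eA; split=> // a b; rewrite !mxE.
have inT (m : 'rV[R]_1) : m \in [set: 'rV[R]_1] by rewrite inE.
have inU (t : R) : j (y, t) \in U by rewrite inE; exists (y, t).
exists (fun x : set_type U => exist _ (const_mx (c (val x)).2) (inT _)); split.
  apply: continuous_into_subspace => x /=.
  apply: (@continuous_comp _ _ _ (fun x : set_type U => (c (val x)).2)
    (fun t => const_mx t : 'rV[R]_1)); last exact: const_c.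
  apply: (@continuous_comp _ _ _ (fun x : set_type U => c (val x)) snd);
    last exact: cvg_snd.
  apply: (@continuous_comp _ _ _ (fun x : set_type U => val x) c).
    exact: set_val_continuous.
  by have [p _ <-] := set_valP x => A; exact: cc.
exists (fun m : set_type [set: 'rV[R]_1] => exist _ (j (y, val m 0 0)) (inU _)).
split.
- apply: continuous_into_subspace => m /=.
  apply: (@continuous_comp _ _ _
    (fun m : set_type [set: 'rV[R]_1] => (y, (val m : 'rV[R]_1) 0 0)) j);
    last exact: j_continuous.
  apply: (@continuous_pair _ _ _ (fun=> y)
    (fun m : set_type [set: 'rV[R]_1] => (val m : 'rV[R]_1) 0 0)) => a.
    exact: (@cst_continuous (set_type [set: 'rV[R]_1]) Y y).
  apply: (@continuous_comp _ _ _
    (fun m : set_type [set: 'rV[R]_1] => val m)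
    (fun M : 'rV[R]_1 => M 0 0)); last exact: coord_continuous.
  exact: set_val_continuous.
- move=> x; apply: val_inj; rewrite /= mxE.
  by have [[u t] [/= -> _] <-] := set_valP x; rewrite jK.
- move=> m; apply: val_inj => /=; rewrite jK /=.
  by apply/rowP => i; rewrite mxE ord1.
Qed.

End open_product.

Section cone_cylinder.
Context (R : realType) (Y X : topologicalType) (k : cylinder R Y -> X).
Hypothesis kP : cone_chart k.

Definition open_cylinder (p : Y * R) : X := k (p.1, expray p.2).

Lemma open_cylinder_continuous : continuous open_cylinder.
Proof.
move=> p.
apply: (@continuous_comp _ _ _ (fun p : Y * R => (p.1, expray p.2) : cylinder R Y) k);
  last exact: chart_continuous kP _.
apply: continuous_pair => q; first exact: cvg_fst.
apply: (@continuous_comp _ _ _ (fun q : Y * R => q.2) (@expray R)).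
  exact: cvg_snd.
exact: expray_continuous.
Qed.

Lemma open_cylinder_inj : injective open_cylinder.
Proof.
move=> [u s] [u' s']; rewrite /open_cylinder /=.
by move=> /(chart_eq kP)/cone_relP[[-> /expR_inj ->]|[]].
Qed.

Lemma open_cylinder_open (O : set (Y * R)) : open O -> open (open_cylinder @` O).
Proof.
move=> Oo; have -> : open_cylinder @` O = k @`
    [set p | exists q, O q /\ p = (q.1, expray q.2)].
  apply/seteqP; split=> [_ [q Oq <-]|_ [_ [q [Oq ->]] <-]].
    by exists (q.1, expray q.2) => //; exists q.
  by exists q.
apply: (chart_open kP); last first.
  by move=> p q /cone_relP[->//|[/= p2 _]] [q' [_ pq']]; move: p2; rewrite pq'.
rewrite openE => _ [[u s] [Oq ->]].
have [[A B] /= [uA sB] AB] := open_nbhs_nbhs (conj Oo Oq).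
exists (A, @expray R @` B).
  split => //=; apply/nbhs_expray; apply: filterS (sB) => t Bt.
  by exists t.
move=> [u' t'] [/= Au' [t Bt <-]]; exists (u', t); split=> //.
exact: (AB (u', t)).
Qed.

End cone_cylinder.

(** * Complete metrics on retracts of open sets *)

(** Joins the completeness and the norm of row vectors, so that they form a
    complete normed module. *)
HB.instance Definition _ (R : realType) m := Complete.on 'rV[R]_m.

Section retracts.
Context (R : realType).

(** The distance to the complement of [U]. *)
Lemma open_positive_function (V : normedModType R) (U : set V) : open U ->
  exists phi : V -> R, continuous phi /\ forall x, U x <-> 0 < phi x.
Proof.
move=> Uo; have [[c0 c0U]|UT] := pselect (~` U !=set0); last first.
  exists (fun=> 1); split; first by move=> ?; exact: cvg_cst.
  move=> x; split=> // _; apply: contrapT => nUx; apply: UT.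
  by exists x.
pose D x := [set `|x - c| | c in ~` U].
have D_lb x : has_lbound (D x) by exists 0 => _ [c _ <-].
have D_ne x : D x !=set0 by exists `|x - c0|; exists c0.
pose phi x := inf (D x).
have lip x y : phi x - phi y <= `|x - y|.
  rewrite lerBlDr -lerBlDl; apply: lb_le_inf; first exact: D_ne.
  move=> _ [c cU <-]; rewrite lerBlDl.
  have : phi x <= `|x - c| by apply: ge_inf; [exact: D_lb | exists c].
  by move/le_trans; apply; have := ler_distD y x c.
exists phi; split=> [x|x].
  apply/cvgrPdist_lt => e e0; near=> y.
  have xy : `|x - y| < e by near: y; exact: cvgr_dist_lt.
  apply: le_lt_trans xy; rewrite ler_norml; apply/andP; split; last exact: lip.
  by have := lip y x; rewrite distrC; lra.
split=> [Ux|phix].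
  have /nbhs_ballP[e /= e0 eU] := open_nbhs_nbhs (conj Uo Ux).
  apply: (lt_le_trans e0); apply: lb_le_inf; first exact: D_ne.
  move=> _ [c cU <-]; rewrite leNgt; apply/negP => xc; apply: cU.
  by apply: eU; rewrite -ball_normE.
apply: contrapT => nUx; suff : phi x <= 0 by lra.
by apply: ge_inf; [exact: D_lb | exists x => //; rewrite subrr normr0].
Unshelve. all: by end_near. Qed.

(** The last clause says that [e] is an embedding: its inverse is continuous. *)
Lemma homeomorphic_embedding (V : normedModType R) (X : topologicalType)
    (A : set V) : homeomorphic X A ->
  exists e : X -> V, [/\ continuous e, injective e, range e = A &
    forall x B, nbhs x B -> exists2 r, 0 < r &
      forall y, `|e x - e y| < r -> B y].
Proof.
move=> [f [fc [g [gc fK gK]]]].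
exists (fun x => val (f x)); split.
- move=> x; apply: (@continuous_comp _ _ _ f (fun z : set_type A => val z)).
    exact: fc.
  exact: set_val_continuous.
- by move=> x y /val_inj /(can_inj fK).
- apply/seteqP; split=> [_ [x _ <-]|v Av]; first exact: set_valP.
  by exists (g (exist _ v (mem_set Av))) => //; rewrite gK.
- move=> x B xB.
  have : nbhs (f x) (g @^-1` B) by apply: gc; rewrite fK.
  move=> /nbhs_set_typeP[W /nbhs_ballP[r /= r0 rW] WB].
  exists r => // y xy; rewrite -(fK y); apply: WB; apply: rW.
  by rewrite -ball_normE.
Qed.

(** A retract [A] of [U] is closed in [U], and [U] is made closed by embedding
    it as the graph of a function that tends to infinity at its boundary.  The
    metric [d] is that of this graph, [rho] being the function. *)
Lemma retract_complete_metric (V : completeNormedModType R)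
    (X : topologicalType) (U A : set V) :
  open U -> is_retract A U -> homeomorphic X A ->
  exists d : X -> X -> R, complete_metric d.
Proof.
move=> Uo [AU [r [rc rA rid]]] /homeomorphic_embedding[e [ec einj eA enbhs]].
have [phi [phic phiU]] := open_positive_function Uo.
have phi0 x : 0 < phi (e x) by apply/phiU/AU; rewrite -eA; exists x.
pose rho x := (phi (e x))^-1.
have rho0 x : 0 < rho x by rewrite invr_gt0.
have rhoc : continuous rho.
  move=> x; apply: cvgV; first by rewrite gt_eqF.
  by apply: (@continuous_comp _ _ _ e phi); [exact: ec | exact: phic].
pose d x y := `|e x - e y| + `|rho x - rho y|.
have d_tri x y z : d x z <= d x y + d y z.
  have := ler_distD (e y) (e x) (e z).
  by have := ler_distD (rho y) (rho x) (rho z); rewrite /d; lra.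
have d_refl x : d x x = 0 by rewrite /d !subrr !normr0 addr0.
exists d; split=> //.
- move=> x y dxy; apply: einj; apply/eqP; rewrite -subr_eq0 -normr_le0.
  by apply: le_trans dxy; rewrite lerDl.
- by move=> x y; rewrite /d distrC (distrC (rho x)).
- move=> x B; split=> [/enbhs[s s0 sB]|[s s0 sB]].
    exists s => // y xy; apply: sB; apply: le_lt_trans xy.
    by rewrite lerDl.
  have s20 : 0 < s / 2 by lra.
  have e_near : \forall y \near x, `|e x - e y| < s / 2.
    by apply: cvgr_dist_lt => //; exact: ec.
  have rho_near : \forall y \near x, `|rho x - rho y| < s / 2.
    by apply: cvgr_dist_lt => //; exact: rhoc.
  apply: filterS (filterI e_near rho_near) => y [h1 h2].
  by apply: sB; rewrite /d; lra.
move=> u fast.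
have tail := geometric_tail d_refl d_tri fast.
have eu_cvg : cvg ((e \o u) @ \oo).
  apply: cauchy_cvg; suff : cauchy_ex ((e \o u) @ \oo) by exact: cauchy_exP.
  move=> s s0.
  have [N HN] := @small_pow2 R (s / 2) ltac:(lra).
  exists (e (u N)); exists N => // m /= Nm; rewrite -ball_normE /=.
  have := tail N m Nm; have := HN N (leqnn N).
  have : 0 <= `|rho (u N) - rho (u m)| by [].
  rewrite /d; lra.
have [l eul] : exists l : V, (e \o u) @ \oo --> l.
  by exists (lim ((e \o u) @ \oo)); exact: eu_cvg.
(* Along the sequence [rho] is bounded by [M], which keeps the limit [l] away
   from the complement of [U]. *)
pose M := rho (u 0%N) + 2.
have M0 : 0 < M by have := rho0 (u 0%N); rewrite /M; lra.
have phi_ge n : M^-1 <= phi (e (u n)).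
  rewrite -[phi _]invrK lef_pV2 ?posrE ?invr_gt0 //.
  have := tail 0%N n isT; have := ler_norm (rho (u n) - rho (u 0%N)).
  rewrite (distrC (rho (u n))) expr0 /d -/(rho (u n)) /M.
  by have : 0 <= `|e (u 0%N) - e (u n)| by []; lra.
have phil : (phi \o (e \o u)) @ \oo --> phi l.
  by apply: continuous_cvg => //; exact: phic.
have Ul : U l.
  apply/phiU; apply: (@lt_le_trans _ _ M^-1); first by rewrite invr_gt0.
  rewrite leNgt; apply/negP => lM.
  have [N _ /(_ N (leqnn N)) /=] :
      \forall n \near \oo, (phi \o (e \o u)) n < M^-1.
    by apply: cvgr_lt lM; exact: phil.
  by have := phi_ge N; lra.
have Al : A l.
  have rl : r l = l.
    have rcl : {for l, continuous r}.
      by move: rc; rewrite continuous_open_subspace // => /(_ l); apply; rewrite inE.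
    have h : (r \o (e \o u)) @ \oo --> r l by exact: continuous_cvg.
    have E : r \o (e \o u) = e \o u.
      by apply/funext => n /=; apply: rid; rewrite -eA; exists (u n).
    by rewrite E in h; exact: (cvg_unique _ h eul).
  by rewrite -rl; exact: rA.
move: (Al); rewrite -eA => -[x _ xl].
exists x => s s0; have s20 : 0 < s / 2 by lra.
have e_near : \forall n \near \oo, `|l - e (u n)| < s / 2.
  by apply: cvgr_dist_lt.
have rho_near : \forall n \near \oo, `|rho x - rho (u n)| < s / 2.
  apply: cvgr_dist_lt => //; rewrite /rho xl; apply: cvgV; last exact: phil.
  by rewrite -xl gt_eqF.
have [N _ HN] := filterI e_near rho_near; exists N => n /HN[/= h1 h2].
by rewrite /d xl distrC (distrC (rho _)); lra.
Qed.

Lemma rational_approx m (v : 'rV[R]_m) (s : R) : 0 < s ->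
  exists q : 'rV[rat]_m, ball (map_mx (@ratr R) q : 'rV[R]_m) s v.
Proof.
move=> s0.
have h (i : 'I_m) : exists q : rat, `|ratr q - v 0 i| < s.
  have /rat_in_itvoo[q] : v 0 i - s < v 0 i + s by lra.
  rewrite in_itv /= => /andP[q1 q2]; exists q.
  by rewrite ltr_norml; apply/andP; split; lra.
have [q qP] := choice h; exists (\row_i q i); split=> // a b.
by rewrite !mxE ord1 /ball /=; exact: qP.
Qed.

Lemma euclidean_second_countable (X : topologicalType) m (A : set 'rV[R]_m) :
  homeomorphic X A -> @second_countable X.
Proof.
move=> /homeomorphic_embedding[e [ec _ _ enbhs]].
pose B (qs : 'rV[rat]_m * rat) : set X :=
  e @^-1` [set v | `|map_mx (@ratr R) qs.1 - v| < ratr qs.2].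
exists (range B); first exact: (sub_countable (card_image_le _ _) (countableP _)).
split=> [_ [qs _ <-]|x N xN].
  rewrite openE => x Bx.
  have near_x : \forall y \near x,
      `|e x - e y| < ratr qs.2 - `|map_mx (@ratr R) qs.1 - e x|.
    by apply: cvgr_dist_lt; [exact: ec | rewrite subr_gt0].
  apply: filterS near_x => y xy.
  by have := ler_distD (e x) (map_mx (@ratr R) qs.1) (e y); rewrite /B /=; lra.
have [r r0 rN] := enbhs x N xN.
have /rat_in_itvoo[s] : r / 4 < r / 2 by lra.
rewrite in_itv /= => /andP[s1 s2].
have [|q] := @rational_approx m (e x) (ratr s); first by lra.
rewrite -ball_normE /= => qx.
exists (B (q, s)); first by split; [exists (q, s) | exact: qx].
move=> y /= qy; apply: rN.
have := ler_distD (map_mx (@ratr R) q) (e x) (e y); rewrite (distrC (e x) (map_mx _ q)).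
move: qy; rewrite /B /=; lra.
Qed.

End retracts.

(** * The theorem *)

Section euclidean_points.
Context (R : realType) (n : nat) (X : topologicalType).

Definition euclidean_at (x : X) := exists (U : set X) (V : set 'rV[R]_n),
  [/\ open U, U x, open V & homeomorphic U V].

Lemma euclidean_fwd (h : selfhomeo X) (x : X) :
  euclidean_at x -> euclidean_at (h x).
Proof.
move=> [U [V [Uo Ux Vo [f [fc [g [gc fK gK]]]]]]].
have inU (z : set_type (h @` U)) : bwd h (val z) \in U.
  by rewrite inE; have [y Uy <-] := set_valP z; rewrite fwdK.
have inhU (z : set_type U) : h (val z) \in h @` U.
  by rewrite inE; exists (val z) => //; exact: set_valP.
exists (h @` U), V; split=> //; first exact: open_fwd.
pose a (z : set_type (h @` U)) : set_type U := exist _ (bwd h (val z)) (inU z).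
pose b (z : set_type U) : set_type (h @` U) := exist _ (h (val z)) (inhU z).
have ac : continuous a.
  apply: continuous_into_subspace => z.
  apply: (@continuous_comp _ _ _ (fun z : set_type (h @` U) => val z) (bwd h)).
    exact: set_val_continuous.
  exact: bwd_continuous.
have bc : continuous b.
  apply: continuous_into_subspace => z.
  apply: (@continuous_comp _ _ _ (fun z : set_type U => val z) h).
    exact: set_val_continuous.
  exact: fwd_continuous.
have aK : cancel a b by move=> z; apply: val_inj; rewrite /= bwdK.
have bK : cancel b a by move=> z; apply: val_inj; rewrite /= fwdK.
exists (f \o a); split.
  by move=> z; apply: continuous_comp; [exact: ac | exact: fc].
exists (b \o g); split; [|exact: can_comp fK aK|exact: can_comp bK gK].
by move=> z; apply: continuous_comp; [exact: gc | exact: bc].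
Qed.

End euclidean_points.

Theorem corollary2 (R : realType) (X : topologicalType)
    (X_conical : locally_conical R X)
    (X_homogeneous : homogeneous X)
    (X_ENR : euclidean_neighborhood_retract R X)
    (X_not_manifold : ~ topological_manifold R X) :
  (forall (x : X) (n : nat), (2 <= n)%N ->
     strongly_homogeneous n (connected_component [set: X] x)) /\
  countable_dense_homogeneous X.
Proof.
have [m [U0 [A [m_ge1 U0_open A_retract XA]]]] := X_ENR.
have [d dP] := retract_complete_metric (V := 'rV[R]_m) U0_open A_retract XA.
have hX : hausdorff_space X := complete_metric_hausdorff dP.
have transport := homogeneous_transport X_homogeneous.
have local_properties (x : X) : [/\ forall z : X, pushable z,
    forall z : X, locally_connected_at z & forall z : X, nonseparating_at z].
  have [U [Y [Uo Ux Yc /(open_cone_chart Uo)[k [kP kU]]]]] := X_conical x.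
  have [[y0 t] _ _] : range k x by rewrite kU.
  pose v := k (y0, infty R).
  have v_push : pushable v by exact: pushable_vertex kP Yc hX _.
  have v_lc : locally_connected_at v by exact: locally_connected_vertex kP Yc _.
  have push := transport _ (@pushable_fwd X) v v_push.
  have lc := transport _ (@locally_connected_fwd X) v v_lc.
  have jc := open_cylinder_continuous kP.
  have ji := open_cylinder_inj kP.
  have jo := open_cylinder_open kP.
  split=> //; apply: (transport _ (@nonseparating_fwd X) (open_cylinder k (y0, 0))).
  apply: nonseparating_product => // y0_isolated; apply: X_not_manifold.
  split=> //; first exact: euclidean_second_countable XA.
  exists 1%N; apply: (transport _ (@euclidean_fwd R 1 X) (open_cylinder k (y0, 0))).
  by have := isolated_euclidean jc ji jo y0_isolated.
have slh : forall x : X, strongly_locally_homogeneous x.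
  move=> x; have [push _ _] := local_properties x.
  apply: (almost_strongly_locally_homogeneous dP).
  have [z zP] := pushable_almost_somewhere dP (ex_intro _ x I) push.
  exact: (transport _ (@almost_locally_homogeneous_fwd X) z zP).
split=> [x n _|]; last exact: strongly_locally_homogeneous_cdh dP slh.
have [_ lc ns] := local_properties x.
apply: open_connected_strongly_homogeneous => //; first exact: open_component.
exact: component_connected.
Qed.
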